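(* Let $\beta$ be a fixed positive integer, let $x$ be a large real number and $y\ge x^{\beta}$. Then \[ C_{1,\beta}(x,y)=y-\frac{x^{1+\beta}}{2(1+\beta)\zeta(1+\beta)}+R_{1,\beta}(x,y), \] where \[ R_{1,\beta}(x,y)\ll_\beta\begin{cases} x\,y^{1/3}\log x+x^3y^{-1}, & \beta=1,\\ x^{\frac{1+2\beta}{3}}y^{1/3}+x^{1+2\beta}y^{-1}, & \beta>1.\end{cases} \]
   Context: For a positive integer $\beta$ and positive integers $q,n$, Cohen's generalized Ramanujan sum is \[ c_{q,\beta}(n):=\sum_{\substack{0\le h<q^{\beta}\\ (h,q^{\beta})_{\beta}=1}} e^{2\pi i n h/q^{\beta}}, \] where $(h,q^\beta)_\beta=1$ means that $h$ and $q^\beta$ have no common divisor which is a $\beta$-th power other than $1$. Define \[ C_{1,\beta}(x,y):=\sum_{n\le y}\sum_{q\le x}c_{q,\beta}(n). \] $\zeta$ is the Riemann zeta function. *)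

(* Defs.v *)
From HB Require Import structures.
From mathcomp Require Import all_boot all_order all_algebra.
From mathcomp Require Import all_classical all_reals all_analysis.
From mathcomp Require Import complex.

Set Implicit Arguments.
Unset Strict Implicit.
Unset Printing Implicit Defensive.

Import Order.TTheory GRing.Theory Num.Theory.
Import numFieldNormedType.Exports.

Local Open Scope ring_scope.
Local Open Scope complex_scope.

Definition cexp (R : realType) (z : R[i]) : R[i] :=
  (expR (complex.Re z))%:C * (cos (complex.Im z) +i* sin (complex.Im z)).

(* Only meaningful for s > 1, where the Dirichlet series converges. *)
Definition zeta (R : realType) (s : R) : R :=
  limn (series (fun n : nat => (n.+1%:R `^ s)^-1)).

(* (a, b)_beta = 1: the only beta-th power dividing both a and b is 1. *)
Definition beta_coprime (beta a b : nat) : Prop :=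
  forall d : nat, (d ^ beta %| a)%N -> (d ^ beta %| b)%N -> (d ^ beta = 1)%N.

Definition cohen_sum (R : realType) (beta q n : nat) : R[i] :=
  \sum_(0 <= h < q ^ beta | `[< beta_coprime beta h (q ^ beta) >])
    cexp ((2 * pi * n%:R * h%:R / (q ^ beta)%:R) *i).

(* For nonnegative y, Num.truncn y is the integer part of y, so that
   the indices 1 <= n < (Num.truncn y).+1 are the positive integers n <= y. *)
Definition C1 (R : realType) (beta : nat) (x y : R) : R[i] :=
  \sum_(1 <= n < (Num.truncn y).+1) \sum_(1 <= q < (Num.truncn x).+1)
    cohen_sum R beta q n.

Definition error_bound (R : realType) (beta : nat) (x y : R) : R :=
  if beta == 1%N
  then x * y `^ (1 / 3) * ln x + x ^+ 3 * y^-1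
  else x `^ ((1 + 2 * beta)%N%:R / 3) * y `^ (1 / 3)
       + x ^+ (1 + 2 * beta) * y^-1.

(* Main.v *)
(* Writing c_q(n) as the sum of mu(g) (q/g)^b over the g | q with (q/g)^b | n gives
   C_1 = sum_(k <= x) mu(k) sum_(d <= x/k) d^b floor(y/d^b).  In each floor, y/d^b
   contributes y, the constant -1/2 contributes minus half a sum of Jordan totients,
   that is, the second main term, and everything else is governed by sums of the
   sawtooth over y/n^b.  On a dyadic block n ~ X these are bounded by van der Corput's
   method: the sawtooth is squeezed between difference quotients of its primitive, whose
   Fourier series converges absolutely, and the sums of cos(2 pi h y/n^b) are estimated
   by Kuzmin-Landau for h y/X^(b+1) small and by the second difference test otherwise.
   All exponential sum estimates use finite differences of n^-b instead of derivatives. *)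

Require Import Defs.
From HB Require Import structures.
From mathcomp Require Import all_boot all_order all_algebra.
From mathcomp Require Import all_classical all_reals all_analysis.
From mathcomp Require Import complex.
From mathcomp Require Import zify ring lra.

Import Order.TTheory GRing.Theory Num.Theory.
Import numFieldNormedType.Exports.

Set Implicit Arguments.
Unset Strict Implicit.
Unset Printing Implicit Defensive.

Local Open Scope ring_scope.

(** * The Kuzmin-Landau inequality and the second difference test *)

(** The exponents come from one optimisation. With H harmonics on a block n ~ X, smoothing costs X/H
    and the second difference test sqrt(H y / X^b); both have size X/Z when H ~ Z =
    (X^(b+2)/y)^(1/3), and the weight n^b turns X/Z into X^((1+2b)/3) y^(1/3). The Kuzmin-Landau
    term X^(b+1)/y becomes X^(1+2b)/y in the same way. Both exponents of X are at least 1, so the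
    dyadic blocks sum geometrically. The outer sum over k then meets (x/k)^((1+2b)/3): for b = 1
    this is a harmonic sum and produces log x, for b > 1 the sum over k converges. The assumption y
    >= x^b absorbs the error of order x^b left by the power sums. The primitive of the sawtooth is
    expanded because the Fourier series of the sawtooth itself converges only conditionally. The
    price is a shift d = 1/H and an approximation accurate to order 1/H^2. The number M of Fourier
    terms this takes is never estimated, since the weighted sums over h are bounded uniformly in
    M. *)

Lemma abel_bound (R : realType) (c s : nat -> R) (C : R) (m p : nat) :
  (forall n, (m <= n < p)%N -> `|c n| <= C) ->
  (forall n, (m <= n)%N -> (n.+1 < p)%N -> c n.+1 <= c n) ->
  (forall n, `|s n| <= 1) -> 0 <= C ->
  `|\sum_(m <= n < p) c n * (s n.+1 - s n)| <= 4 * C.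
Proof.
move=> cC cdec s1 C0; have [pm|mp] := leqP p m.
  by rewrite big_geq// normr0; lra.
case: p mp cC cdec => // p mp cC cdec; rewrite ltnS in mp.
(* Both boundary terms stay inside the norm, so each induction step adds only (c q - c q.+1) s q.+1
   and the variation telescopes. Boundary terms and variation then cost at most 2 C each. *)
have key q : (m <= q <= p)%N ->
    `|\sum_(m <= n < q.+1) c n * (s n.+1 - s n) - c q * s q.+1 + c m * s m|
      <= c m - c q.
  elim: q => [|q IH] /andP[mq qp].
    move: mq; rewrite leqn0 => /eqP ->; rewrite big_nat1 subrr.
    by rewrite (_ : _ + _ = 0) ?normr0//; ring.
  move: mq; rewrite leq_eqVlt ltnS => /orP[/eqP mq|mq].
    rewrite -mq big_nat1 subrr.
    by rewrite (_ : _ + _ = 0) ?normr0//; ring.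
  rewrite big_nat_recr/=; last by rewrite ltnW.
  have /= IHq := IH ltac:(by rewrite mq ltnW).
  rewrite (_ : _ + _ = \sum_(m <= n < q.+1) c n * (s n.+1 - s n)
     - c q * s q.+1 + c m * s m + (c q - c q.+1) * s q.+1); last by ring.
  have hc : c q.+1 <= c q by apply: cdec.
  apply: le_trans (ler_normD _ _) _; rewrite normrM (ger0_norm (x := c q - _)).
    by have := s1 q.+1; nra.
  by rewrite subr_ge0.
have := key p ltac:(by rewrite mp leqnn).
have hm := cC m ltac:(by rewrite leqnn ltnS mp).
have hp := cC p ltac:(by rewrite mp ltnS leqnn).
have hsm := s1 m; have hsp := s1 p.+1.
have h1 : `|c p * s p.+1| <= C by rewrite normrM; have := normr_ge0 (c p); nra.
have h2 : `|c m * s m| <= C by rewrite normrM; have := normr_ge0 (c m); nra.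
move: hm hp h1 h2; rewrite !ler_norml; lra.
Qed.

Lemma sin_ge_xcos (R : realType) (x : R) : 0 <= x <= pi -> x * cos x <= sin x.
Proof.
move=> /andP[x0 xpi]; case: (ltgtP 0 x) x0 => // [x0 _|<- _]; last first.
  by rewrite mul0r sin0.
pose f (t : R) := sin t - t * cos t.
have fd (t : R) : is_derive t 1 f (t * sin t).
  rewrite /f; apply: is_derive_eq => /=.
  by rewrite !scaler1 /GRing.scale/=; ring.
have [|c] := @MVT _ f (fun t => t * sin t) 0 x x0 (fun t _ => fd t).
  by apply: derivable_within_continuous => t _; exact: ex_derive.
rewrite in_itv/= => /andP[c0 cx]; rewrite /f sin0 mul0r !subr0 => e.
have : 0 <= sin c by apply: sin_ge0_pi; apply/andP; split; lra.
by move=> hs; rewrite -subr_ge0 e !mulr_ge0// ltW.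
Qed.

(** For u <= 1/2 put x = pi u / 2. Then sin 2x = 2 sin x cos x >= 2 x cos^2 x >= x >= u, because cos
    2x >= 0 gives cos^2 x >= 1/2 and pi >= 2. The reflection t -> 1 - t covers the other half. *)
Lemma sin_pi_ge (R : realType) (t th : R) : 0 <= th -> th <= t <= 1 - th ->
  th <= sin (pi * t).
Proof.
move=> th0.
have hpi := pi_ge2 R.
have half (u : R) : 0 <= u <= 2^-1 -> u <= sin (pi * u).
  move=> /andP[u0 u1].
  set x := pi * u / 2.
  have ex : pi * u = x *+ 2 by rewrite /x mulr2n; lra.
  have x0 : 0 <= x by rewrite /x; nra.
  have x1 : x *+ 2 <= pi / 2 by rewrite -ex; nra.
  have hx : x * cos x <= sin x.
    by apply: sin_ge_xcos; rewrite x0/=; move: x1; rewrite mulr2n; lra.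
  have c1 : 0 <= cos x.
    by apply: cos_ge0_pihalf; apply/andP; move: x1; rewrite mulr2n; split; lra.
  have c2 : 0 <= cos (x *+ 2).
    by apply: cos_ge0_pihalf; apply/andP; move: x1; rewrite mulr2n; split; lra.
  rewrite ex sin_mulr2n mulr2n; move: c2; rewrite cos_mulr2n mulr2n => c2.
  have : x * (cos x ^+ 2) <= cos x * sin x by rewrite expr2; nra.
  have : x * (cos x ^+ 2) >= x * 2^-1 by apply: ler_wpM2l => //; lra.
  have : u <= x by rewrite /x; nra.
  lra.
move=> /andP[tt t1]; have [tl|tg] := lerP t 2^-1.
  by apply: (le_trans tt); apply: half; apply/andP; split; lra.
have -> : sin (pi * t) = sin (pi * (1 - t)).
  by rewrite mulrBr mulr1 sinB sinpi cospi; ring.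
by apply: (@le_trans _ _ (1 - t)); [lra|apply: half; apply/andP; split; lra].
Qed.

Lemma cos_shift (R : realType) (x : R) (k : int) :
  cos (2 * pi * (x + k%:~R)) = cos (2 * pi * x).
Proof.
have H (n : nat) (y : R) : cos (2 * pi * (y + n%:R)) = cos (2 * pi * y).
  rewrite (_ : _ * (_ + _) = 2 * pi * y + (pi *+ 2) *+ n); last first.
    by rewrite -[_ *+ n]mulr_natr -[_ *+ 2]mulr_natr; ring.
  exact/(periodicn (@cosD2pi R)).
case: k => n; first by rewrite -(H n x).
by rewrite -[LHS](H n.+1) NegzE mulrNz subrK.
Qed.

(* Idea: cos a is half of (cos a - cos b) + cot ((b - a) / 2) (sin b - sin a); the first
   part telescopes and the cotangent is monotone, so Abel summation applies. *)
Lemma kuzmin_landau0 (R : realType) (F : nat -> R) (th : R) (m p : nat) :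
  0 < th ->
  (forall n, (m <= n < p)%N -> th <= F n.+1 - F n <= 1 - th) ->
  (forall n, (m <= n)%N -> (n.+1 < p)%N -> F n.+1 - F n <= F n.+2 - F n.+1) ->
  `|\sum_(m <= n < p) cos (2 * pi * F n)| <= 3 / th.
Proof.
move=> th0 hth hmon.
have [pm|mp] := leqP p m.
  by rewrite big_geq// normr0 divr_ge0//; lra.
have th1 : th <= 2^-1.
  by have := hth m ltac:(by rewrite leqnn mp); lra.
(* The telescoped boundary part is at most 1; this bound absorbs it into 1/th, next to 2/th from
   Abel summation, whence the constant 3. *)
have i1 : 1 <= th^-1 by rewrite invf_ge1//; lra.
pose d n := F n.+1 - F n.
have sge n : (m <= n < p)%N -> th <= sin (pi * d n).
  by move=> /hth h; apply: sin_pi_ge => //; exact: ltW.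
pose c n := cos (pi * d n) / sin (pi * d n).
have eqc n : (m <= n < p)%N -> cos (2 * pi * F n) =
   2^-1 * (cos (2 * pi * F n) - cos (2 * pi * F n.+1)) +
   2^-1 * (c n * (sin (2 * pi * F n.+1) - sin (2 * pi * F n))).
  move=> /sge h.
  have sn0 : sin (pi * d n) != 0 by rewrite gt_eqF//; lra.
  rewrite (_ : 2 * pi * F n.+1 = 2 * pi * F n + (pi * d n) *+ 2); last first.
    by rewrite /d -mulr_natr; ring.
  rewrite (cosD (2 * pi * F n)) (sinD (2 * pi * F n)) cos_mulr2n sin_mulr2n.
  rewrite /c; have := cos2Dsin2 (pi * d n); move: sn0.
  move: (cos (2 * _ * _)) (sin (2 * _ * _)) (cos (pi * _)) (sin (pi * _)).
  move=> C S Y X X0 CS; rewrite !mulr2n.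
  have -> : S * (Y ^+ 2 + Y ^+ 2 - 1) + C * (Y * X + Y * X) - S =
    X * (2 * C * Y - 2 * S * X).
    have -> : Y ^+ 2 = 1 - X ^+ 2 by rewrite -CS; ring.
    by ring.
  by rewrite [Y / X * _]mulrA divfK//; field.
rewrite (eq_big_nat _ _ eqc) big_split/= -!big_distrr/=.
have tel : \sum_(m <= n < p) (cos (2 * pi * F n) - cos (2 * pi * F n.+1)) =
   cos (2 * pi * F m) - cos (2 * pi * F p).
  rewrite -[LHS]opprK -sumrN.
  rewrite (eq_bigr (fun n => cos (2 * pi * F n.+1) - cos (2 * pi * F n))).
    by rewrite (telescope_sumr (fun n => cos (2 * pi * F n))) ?opprB// ltnW.
  by move=> n _; rewrite opprB.
have B : `|\sum_(m <= n < p) c n * (sin (2 * pi * F n.+1) - sin (2 * pi * F n))|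
    <= 4 * th^-1.
  apply: (@abel_bound _ c (fun n => sin (2 * pi * F n))).
  - move=> n /sge h; rewrite /c normrM normfV ler_pdivrMr; last first.
      by rewrite normr_gt0 gt_eqF//; lra.
    apply: le_trans (cos_max _) _.
    rewrite ger0_norm; last lra.
    by rewrite mulrC ler_pdivlMr// mul1r.
  - move=> n mn np; rewrite /c.
    have h1 := sge n ltac:(by rewrite mn ltnW).
    have h2 := sge n.+1 ltac:(by rewrite np leqW).
    rewrite ler_pdivrMr; last lra.
    rewrite mulrAC ler_pdivlMr; last lra.
    rewrite -subr_ge0.
    (* After cross-multiplication, the decrease of the cotangent is the sign of the sine of pi times
       the second difference, which lies between 0 and 1. *)
    have -> : cos (pi * d n) * sin (pi * d n.+1) - cos (pi * d n.+1) * sin (pi * d n)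
       = sin (pi * (d n.+1 - d n)).
      by rewrite (mulrBr pi (d _)) sinB; ring.
    apply: sin_ge0_pi.
    have := hth n ltac:(by rewrite mn ltnW).
    have := hth n.+1 ltac:(by rewrite np leqW).
    have := hmon n mn np; rewrite -!/(d _).
    have := pi_gt0 R; nra.
  - by move=> n; exact: sin_max.
  - by lra.
rewrite tel.
have := cos_max (2 * pi * F m); have := cos_max (2 * pi * F p).
move: B; rewrite !ler_norml; move: (\sum_(_ <= _ < _) _) => S; lra.
Qed.

Lemma gap_le (R : realType) (d : nat -> R) (lam : R) (m p : nat) :
  (forall n, (m <= n)%N -> (n.+1 < p)%N -> d n + lam <= d n.+1) ->
  forall i j, (m <= i)%N -> (i <= j)%N -> (j < p)%N ->
    d i + (j - i)%N%:R * lam <= d j.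
Proof.
move=> h i j mi; elim: j => [|j IH].
  by rewrite leqn0 => /eqP ->; rewrite subnn; lra.
rewrite leq_eqVlt => /orP[/eqP <- _|]; first by rewrite subnn; lra.
rewrite ltnS => ij jp; have := IH ij (ltnW jp).
have := h j (leq_trans mi ij) jp.
by rewrite subSn// -natr1; lra.
Qed.

(** Cutting a monotone sequence at a level yields index intervals, so that the exponential sum
    splits into consecutive blocks rather than scattered index sets. *)
Lemma mono_split (R : realType) (d : nat -> R) (c : R) (m p : nat) :
  (m <= p)%N ->
  (forall i j, (m <= i)%N -> (i <= j)%N -> (j < p)%N -> d i <= d j) ->
  exists q, [/\ (m <= q <= p)%N, forall n, (m <= n < q)%N -> d n < c &
                forall n, (q <= n < p)%N -> c <= d n].
Proof.
elim: p => [|p IH].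
  by rewrite leqn0 => /eqP -> _; exists 0%N; split=> // n; rewrite ltn0 andbF.
rewrite leq_eqVlt => /orP[/eqP <- _|].
  exists m; split; rewrite ?leqnn// => n /andP[h1 h2];
    by move: (leq_ltn_trans h1 h2); rewrite ltnn.
rewrite ltnS => mp mon.
have [i j mi ij jp|q [/andP[mq qp] h1 h2]] := IH mp.
  by apply: mon => //; exact: ltnW.
move: qp; rewrite leq_eqVlt => /orP[/eqP qp|qp]; last first.
  exists q; split=> //; first by rewrite mq ltnW// ltnW.
  move=> n /andP[qn]; rewrite ltnS leq_eqVlt => /orP[/eqP ->|np]; last first.
    by apply: h2; rewrite qn.
  apply: le_trans (h2 q _) _; first by rewrite leqnn.
  by apply: mon => //; exact: ltnW.
subst q; have [dc|cd] := ltrP (d p) c.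
  exists p.+1; split=> [||n /andP[a b]]; rewrite ?leqnn ?leqW//.
    move=> n /andP[mn]; rewrite ltnS leq_eqVlt => /orP[/eqP ->//|np].
    by apply: h1; rewrite mn.
  by move: (leq_ltn_trans a b); rewrite ltnn.
exists p; split=> //; first by rewrite mp leqnSn.
by move=> n /andP[pn]; rewrite ltnS => np; have /eqP -> : n == p by rewrite eqn_leq np.
Qed.

Lemma norm_sum_cos_le (R : realType) (F : nat -> R) (m p : nat) :
  (m <= p)%N -> `|\sum_(m <= n < p) cos (F n)| <= (p - m)%N%:R.
Proof.
move=> mp; apply: le_trans (ler_norm_sum _ _ _) _.
apply: (@le_trans _ _ (\sum_(m <= n < p) 1)).
  by apply: ler_sum => n _; exact: cos_max.
by rewrite sumr_const_nat.
Qed.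

Lemma count_gap (R : realType) (d : nat -> R) (lam w a : R) (m p : nat) :
  0 < lam -> 0 <= w -> (m <= p)%N ->
  (forall n, (m <= n)%N -> (n.+1 < p)%N -> d n + lam <= d n.+1) ->
  (forall n, (m <= n < p)%N -> a <= d n < a + w) ->
  (p - m)%N%:R <= w / lam + 1.
Proof.
move=> l0 w0 mp gap h; move: mp; rewrite leq_eqVlt => /orP[/eqP ->|mp].
  by rewrite subnn addr_ge0// divr_ge0// ltW.
case: p mp gap h => // p mp gap h; rewrite ltnS in mp.
have := gap_le gap (leqnn m) mp (ltnSn p).
have := h m ltac:(by rewrite leqnn ltnS mp).
have := h p ltac:(by rewrite mp ltnS leqnn).
rewrite subSn// -natr1 => h1 h2 h3; rewrite lerD2r ler_pdivlMr//; lra.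
Qed.

(* Terms whose increment is within th of an integer are counted by the gap lam; the
   others are handled by Kuzmin-Landau. *)
Lemma second_diff_unit (R : realType) (F : nat -> R) (th lam : R) (m p : nat) :
  0 < th -> th <= 2^-1 -> 0 < lam -> (m <= p)%N ->
  (forall n, (m <= n)%N -> (n.+1 < p)%N ->
     F n.+1 - F n + lam <= F n.+2 - F n.+1) ->
  (forall n, (m <= n < p)%N -> 0 <= F n.+1 - F n < 1) ->
  `|\sum_(m <= n < p) cos (2 * pi * F n)| <= 2 * (th / lam + 1) + 3 / th.
Proof.
move=> th0 th1 l0 mp gap h.
have mon i j : (m <= i)%N -> (i <= j)%N -> (j < p)%N ->
    F i.+1 - F i <= F j.+1 - F j.
  move=> mi ij jp; have /= := gap_le gap mi ij jp.
  by apply: le_trans; rewrite lerDl mulr_ge0// ltW.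
have [q1 [/andP[mq qp] ha hb]] := mono_split th mp mon.
have [|q2 [/andP[q12 q2p] hc hd]] := mono_split (d := fun n => F n.+1 - F n) (1 - th) qp.
  by move=> i j qi; apply: mon; exact: leq_trans qi.
rewrite (big_cat_nat mq)//= (big_cat_nat q12)//=.
have b1 : `|\sum_(m <= n < q1) cos (2 * pi * F n)| <= th / lam + 1.
  apply: le_trans (norm_sum_cos_le _ _) _ => //.
  apply: (@count_gap _ (fun n => F n.+1 - F n) lam th 0) => //; first exact: ltW.
    by move=> n mn nq; apply: gap => //; exact: leq_trans nq qp.
  move=> n /andP[mn nq]; rewrite add0r ha ?mn// andbT.
  by have /andP[] := h n ltac:(by rewrite mn (leq_trans nq qp)).
have b2 : `|\sum_(q1 <= n < q2) cos (2 * pi * F n)| <= 3 / th.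
  apply: kuzmin_landau0 => //.
    move=> n /andP[q1n nq2]; rewrite hb ?q1n ?(leq_trans nq2)//=.
    by rewrite ltW// hc// q1n.
  move=> n q1n nq; apply: mon => //; first exact: leq_trans q1n.
  exact: leq_trans nq q2p.
have b3 : `|\sum_(q2 <= n < p) cos (2 * pi * F n)| <= th / lam + 1.
  apply: le_trans (norm_sum_cos_le _ _) _ => //.
  apply: (@count_gap _ (fun n => F n.+1 - F n) lam th (1 - th)) => //; first exact: ltW.
    move=> n mn nq; apply: gap => //.
    by rewrite (leq_trans _ mn)// (leq_trans mq).
  move=> n /andP[mn nq]; rewrite hd ?mn// subrK/=.
  have /andP[]// := h n ltac:(by rewrite nq (leq_trans _ mn)// (leq_trans mq)).
apply: le_trans (ler_normD _ _) _.
have := ler_normD (\sum_(q1 <= n < q2) cos (2 * pi * F n)) (\sum_(q2 <= n < p) cos (2 * pi * F n)).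
lra.
Qed.

(** The monotone increments cross K unit windows. On each window the integer part k of the increment
    is removed by subtracting k n from F, which the cosine does not see, and the one-window bound
    applies. The parameter [th] stays free in order to be balanced against [lam] later. *)
Lemma second_diff_test (R : realType) (F : nat -> R) (th lam : R) (k : int)
    (K : nat) (m p : nat) :
  0 < th -> th <= 2^-1 -> 0 < lam -> (m <= p)%N ->
  (forall n, (m <= n)%N -> (n.+1 < p)%N ->
     F n.+1 - F n + lam <= F n.+2 - F n.+1) ->
  (forall n, (m <= n < p)%N -> k%:~R <= F n.+1 - F n < k%:~R + K%:R) ->
  `|\sum_(m <= n < p) cos (2 * pi * F n)| <= K%:R * (2 * (th / lam + 1) + 3 / th).
Proof.
move=> th0 th1 l0; elim: K m k => [|K IH] m k mp gap h.
  move: mp; rewrite leq_eqVlt => /orP[/eqP ->|mp].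
    by rewrite big_geq// normr0 mul0r.
  by have := h m ltac:(by rewrite leqnn mp); lra.
have mon i j : (m <= i)%N -> (i <= j)%N -> (j < p)%N ->
    F i.+1 - F i <= F j.+1 - F j.
  move=> mi ij jp; have /= := gap_le gap mi ij jp.
  by apply: le_trans; rewrite lerDl mulr_ge0// ltW.
have [q [/andP[mq qp] ha hb]] := mono_split (k%:~R + 1) mp mon.
rewrite (big_cat_nat mq)//=; apply: le_trans (ler_normD _ _) _.
set B := 2 * _ + _.
have -> : K.+1%:R * B = B + K%:R * B by rewrite -(natr1 K); ring.
apply: lerD; last first.
  apply: (IH q (k + 1)) => // [n qn np|n /andP[qn np]].
    by apply: gap => //; exact: leq_trans qn.
  rewrite intrD hb ?qn//=.
  have := h n ltac:(by rewrite np (leq_trans mq qn)).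
  by rewrite -natr1; lra.
rewrite (eq_bigr (fun n => cos (2 * pi * (F n - k%:~R * n%:R)))); last first.
  move=> n _; rewrite -[LHS](cos_shift _ (- k * n%:Z)); congr (cos (_ * _)).
  by rewrite intrM mulrNz mulNr.
apply: (@second_diff_unit _ (fun n => F n - k%:~R * n%:R)) => //.
  move=> n mn nq; have := gap n mn (leq_trans nq qp).
  by rewrite -!natr1; lra.
move=> n /andP[mn nq].
have := ha n ltac:(by rewrite mn nq).
have := h n ltac:(by rewrite mn (leq_trans nq qp)).
by rewrite -!natr1; lra.
Qed.

(** The shift by k is needed because y / n^b decreases: its small negative increments lie just below
    0, in the window k = -1. *)
Lemma kuzmin_landau (R : realType) (F : nat -> R) (th : R) (k : int) (m p : nat) :
  0 < th ->
  (forall n, (m <= n < p)%N -> k%:~R + th <= F n.+1 - F n <= k%:~R + 1 - th) ->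
  (forall n, (m <= n)%N -> (n.+1 < p)%N -> F n.+1 - F n <= F n.+2 - F n.+1) ->
  `|\sum_(m <= n < p) cos (2 * pi * F n)| <= 3 / th.
Proof.
move=> th0 h mon.
rewrite (eq_bigr (fun n => cos (2 * pi * (F n - k%:~R * n%:R)))); last first.
  move=> n _; rewrite -[LHS](cos_shift _ (- k * n%:Z)); congr (cos (_ * _)).
  by rewrite intrM mulrNz mulNr.
apply: (@kuzmin_landau0 _ (fun n => F n - k%:~R * n%:R)) => //.
  by move=> n /h; rewrite -natr1; lra.
by move=> n mn np; have := mon n mn np; rewrite -!natr1; lra.
Qed.

(** * Fourier expansion of the squared sawtooth primitive *)

Lemma is_derive_cos_scale (R : realType) (a t : R) :
  is_derive t 1 (fun u : R => cos (a * u)) (- a * sin (a * t)).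
Proof.
have h : is_derive t 1 (fun u : R => a * u) a.
  by apply: is_derive_eq; rewrite /GRing.scale/=; ring.
have := @is_derive1_comp R cos (fun u => a * u) t _ _ (is_derive_cos _) h.
by move=> hc; apply: (@is_derive_eq _ _ _ _ _ _ _ _ hc); ring.
Qed.

Lemma is_derive_sin_scale (R : realType) (a t : R) :
  is_derive t 1 (fun u : R => sin (a * u)) (a * cos (a * t)).
Proof.
have h : is_derive t 1 (fun u : R => a * u) a.
  by apply: is_derive_eq; rewrite /GRing.scale/=; ring.
have := @is_derive1_comp R sin (fun u => a * u) t _ _ (is_derive_sin _) h.
by move=> hc; apply: (@is_derive_eq _ _ _ _ _ _ _ _ hc); ring.
Qed.

Lemma is_derive_sum_nat (R : realType) (f : nat -> R -> R) (df : nat -> R)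
    (M : nat) (t : R) :
  (forall h, (0 < h)%N -> is_derive t 1 (f h) (df h)) ->
  is_derive t 1 (fun u : R => \sum_(1 <= h < M.+1) f h u)
    (\sum_(1 <= h < M.+1) df h).
Proof.
move=> fd; elim: M => [|M IH].
  rewrite big_geq//.
  under [fun u : R => _]funext do rewrite big_geq//.
  exact: is_derive_cst.
rewrite big_nat_recr//=.
under [fun u : R => _]funext do rewrite big_nat_recr//=.
by have := is_deriveD IH (fd M.+1 isT).
Qed.

Lemma lipschitz_of_deriv (R : realType) (f df : R -> R) (a b K : R) :
  a <= b -> (forall x, a <= x <= b -> is_derive x 1 f (df x)) ->
  (forall x, a <= x <= b -> `|df x| <= K) -> `|f b - f a| <= K * (b - a).
Proof.
move=> ab fd hK.
have [||c] := @MVT_segment _ f df a b ab.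
- by move=> t; rewrite in_itv/= => /andP[h1 h2]; apply: fd; rewrite !ltW.
- apply: derivable_within_continuous => t; rewrite in_itv/= => /fd h.
  exact: ex_derive.
rewrite in_itv/= => /hK hc ->; rewrite normrM.
by rewrite (ger0_norm (x := b - a)) ?subr_ge0// ler_wpM2r// subr_ge0.
Qed.

(** Partial sum of the Fourier series of pi^2 (t^2 - t + 1/6) on [0, 1]. *)
Definition cos_series (R : realType) (M : nat) (t : R) : R :=
  \sum_(1 <= h < M.+1) cos (2 * pi * h%:R * t) / h%:R ^+ 2.

(* pi times this function is the derivative of pi^2 (t^2 - t) - cos_series M t. *)
Definition cos_series_defect (R : realType) (M : nat) (t : R) : R :=
  pi * (2 * t - 1) + 2 * \sum_(1 <= h < M.+1) sin (2 * pi * h%:R * t) / h%:R.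

Lemma dirichlet_kernel (R : realType) (M : nat) (t : R) :
  sin (pi * t) * (1 + 2 * \sum_(1 <= h < M.+1) cos (2 * pi * h%:R * t)) =
  sin (M.*2.+1%:R * (pi * t)).
Proof.
elim: M => [|M IH]; first by rewrite big_geq// mulr0 addr0 mulr1 mul1r.
rewrite big_nat_recr//=; move: IH; set S := \sum_(_ <= _ < _) _ => IH.
rewrite (_ : sin _ * _ = sin (pi * t) * (1 + 2 * S)
  + 2 * sin (pi * t) * cos (2 * pi * M.+1%:R * t)); last by ring.
rewrite IH.
have -> : M.+1.*2.+1%:R * (pi * t) = 2 * pi * M.+1%:R * t + pi * t.
  by rewrite -muln2 -[in LHS]natr1 natrM; ring.
have -> : M.*2.+1%:R * (pi * t) = 2 * pi * M.+1%:R * t - pi * t.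
  by rewrite -muln2 -[in LHS]natr1 natrM -(natr1 M); ring.
by rewrite sinB sinD; ring.
Qed.

Lemma is_derive_cos_series_defect (R : realType) (M : nat) (t : R) :
  is_derive t 1 (@cos_series_defect R M)
    (2 * pi * (1 + 2 * \sum_(1 <= h < M.+1) cos (2 * pi * h%:R * t))).
Proof.
have h1 (h : nat) : (0 < h)%N -> is_derive t 1
    (fun u : R => sin (2 * pi * h%:R * u) / h%:R)
    (2 * pi * cos (2 * pi * h%:R * t)).
  case: h => // h _.
  have hs := @is_derive_sin_scale R (2 * pi * h.+1%:R) t.
  have hc := @is_deriveM R R _ (cst (h.+1%:R^-1)) t 1 _ _ hs (is_derive_cst _ _ _).
  by apply: (is_derive_eq hc); rewrite /GRing.scale/=; field.
have h2 := is_derive_sum_nat M h1.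
have h3 : is_derive t 1 (fun u : R => pi * (2 * u - 1)) (2 * pi).
  by apply: is_derive_eq; rewrite /GRing.scale/=; ring.
have h4 := is_deriveD h3 (is_deriveZ 2 h2).
apply: (is_derive_eq h4).
by rewrite /GRing.scale/= -big_distrr/=; ring.
Qed.

Lemma is_derive_parabola_sub_cos_series (R : realType) (M : nat) (t : R) :
  is_derive t 1 (fun u : R => pi ^+ 2 * (u ^+ 2 - u) - cos_series M u) (pi * cos_series_defect M t).
Proof.
have h1 (h : nat) : (0 < h)%N -> is_derive t 1
    (fun u : R => cos (2 * pi * h%:R * u) / h%:R ^+ 2)
    (- (2 * pi) * (sin (2 * pi * h%:R * t) / h%:R)).
  case: h => // h _.
  have hs := @is_derive_cos_scale R (2 * pi * h.+1%:R) t.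
  have hc := @is_deriveM R R _ (cst ((h.+1%:R ^+ 2)^-1)) t 1 _ _ hs (is_derive_cst _ _ _).
  by apply: (is_derive_eq hc); rewrite /GRing.scale/=; field.
have h2 := is_derive_sum_nat M h1.
have h3 : is_derive t 1 (fun u : R => pi ^+ 2 * (u ^+ 2 - u)) (pi ^+ 2 * (2 * t - 1)).
  by apply: is_derive_eq; rewrite /GRing.scale/=; ring.
have h4 := is_deriveB h3 h2.
apply: (is_derive_eq h4).
by rewrite /cos_series_defect -big_distrr/=; ring.
Qed.

Lemma pi_lt4 (R : realType) : pi < 4 :> R.
Proof. by have := pihalf_lt2 R; lra. Qed.

(* The derivative of the defect is a Dirichlet kernel; adding the integrated oscillating
   factor w makes it of size 1/M away from the integers. *)
Lemma cos_series_defect_bound (R : realType) (M : nat) (e t : R) :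
  0 < e -> e <= t <= 1 - e -> `|cos_series_defect M t| <= 8 / (M.*2.+1%:R * e ^+ 2).
Proof.
move=> e0 et; have e1 : e <= 2^-1 by lra.
have [K eK] : exists K : R, K = M.*2.+1%:R by eexists.
rewrite -eK; have K0 : 0 < K by rewrite eK ltr0n.
have hpi := pi_lt4 R; have hpi0 := pi_gt0 R.
have sge (u : R) : e <= u <= 1 - e -> e <= sin (pi * u) by move=> hu; apply: sin_pi_ge => //; lra.
(* The derivative of the added term cancels the Dirichlet kernel sin(K pi u)/sin(pi u) and leaves a
   remainder of order 1/K: an integration by parts in differential form. *)
pose w (u : R) := cos_series_defect M u + 2 / K * (cos (K * pi * u) / sin (pi * u)).
pose dw (u : R) := - (2 * pi * cos (K * pi * u) * cos (pi * u) / (K * sin (pi * u) ^+ 2)).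
have wd u : e <= u <= 1 - e -> is_derive u 1 w (dw u).
  move=> hu; have s0 := sge u hu.
  have sn0 : sin (pi * u) != 0 by rewrite gt_eqF//; lra.
  have h1 := is_derive_cos_series_defect M u.
  have h2 := is_deriveV (f := fun v => sin (pi * v)) sn0 (is_derive_sin_scale pi u).
  have h3 := is_deriveM (is_derive_cos_scale (K * pi) u) h2.
  have h4 := is_deriveD h1 (is_deriveZ (2 / K) h3).
  apply: (is_derive_eq h4).
  have -> : 1 + 2 * \sum_(1 <= h < M.+1) cos (2 * pi * h%:R * u) =
     sin (K * (pi * u)) / sin (pi * u).
    by rewrite eK -dirichlet_kernel mulrAC divff// mul1r.
  have -> : K * (pi * u) = K * pi * u by ring.
  rewrite /GRing.scale/= /dw; have K1 : K != 0 by rewrite gt_eqF.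
  by field; rewrite K1 sn0.
have dwb u : e <= u <= 1 - e -> `|dw u| <= 8 / (K * e ^+ 2).
  move=> hu; have s0 := sge u hu.
  have se : e ^+ 2 <= sin (pi * u) ^+ 2 by rewrite !expr2; nra.
  rewrite /dw normrN !normrM normfV normrM (ger0_norm (ltW K0)).
  rewrite (ger0_norm (x := sin _ ^+ 2)) ?sqr_ge0//.
  have s1 : 0 < sin (pi * u) by lra.
  apply: ler_pM; first by rewrite !mulr_ge0.
  - by rewrite invr_ge0 mulr_ge0 ?sqr_ge0 ?(ltW K0).
  - have := cos_max (K * pi * u); have := cos_max (pi * u).
    have := normr_ge0 (cos (K * pi * u)); have := normr_ge0 (cos (pi * u)).
    rewrite (ger0_norm (x := 2))// (ger0_norm (ltW hpi0)).
    move: `|cos (pi * u)| `|cos (K * pi * u)| => a b a0 b0 a1 b1.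
    have := ler_pM a0 b0 a1 b1; have := mulr_ge0 a0 b0.
    move=> c0 c1; suff : 2 * pi * (a * b) <= 8 by lra.
    by move: (a * b) c0 c1 => c; nra.
  - by rewrite lef_pV2 ?posrE ?mulr_gt0 ?exprn_gt0//; apply: ler_wpM2l => //; exact: ltW.
(* The midpoint is the base point of the mean value bound: K is odd, so every term vanishes there.
   Its distance to t is at most 1/2, the factor in [wb]. *)
have whalf : w 2^-1 = 0.
  rewrite /w /cos_series_defect.
  have -> : cos (K * pi * 2^-1) = 0.
    have -> : K * pi * 2^-1 = pi / 2 + pi *+ M.
      by rewrite eK -natr1 -muln2 natrM -[_ *+ M]mulr_natr; field.
    have e2 n : cos (pi / 2 + pi *+ n : R) = 0.
      elim: n => [|n IH]; first by rewrite mulr0n addr0 cos_pihalf.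
      by rewrite (mulrSr pi) addrA cosDpi IH oppr0.
    exact: e2.
  rewrite big1; first by rewrite mul0r !mulr0 !addr0; field.
  move=> h _; have -> : 2 * pi * h%:R * 2^-1 = 0 + pi *+ h :> R.
    by rewrite -[_ *+ h]mulr_natr; field.
  have -> : sin (0 + pi *+ h : R) = 0.
    have e3 n : sin (0 + pi *+ n : R) = 0.
      elim: n => [|n IH]; first by rewrite mulr0n addr0 sin0.
      by rewrite (mulrSr pi) addrA sinDpi IH oppr0.
    exact: e3.
  by rewrite mul0r.
have D0 : 0 <= 8 / (K * e ^+ 2) by rewrite divr_ge0 ?mulr_ge0 ?sqr_ge0// ltW.
have wb : `|w t| <= 8 / (K * e ^+ 2) * 2^-1.
  have [tl|tg] := lerP t 2^-1.
    have := @lipschitz_of_deriv R w dw t 2^-1 (8 / (K * e ^+ 2)) tl.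
    rewrite whalf sub0r normrN => h.
    apply: le_trans (h _ _) _ => [x hx|x hx|]; [apply: wd|apply: dwb|apply: ler_wpM2l => //]; lra.
  have := @lipschitz_of_deriv R w dw 2^-1 t (8 / (K * e ^+ 2)) (ltW tg).
  rewrite whalf subr0 => h.
  apply: le_trans (h _ _) _ => [x hx|x hx|]; [apply: wd|apply: dwb|apply: ler_wpM2l => //]; lra.
have cb : `|2 / K * (cos (K * pi * t) / sin (pi * t))| <= 8 / (K * e ^+ 2) * 2^-1.
  have s0 := sge t et.
  rewrite !normrM !normfV (ger0_norm (ltW K0)) (ger0_norm (x := 2))//.
  rewrite (ger0_norm (x := sin _)); last lra.
  have -> : 8 / (K * e ^+ 2) * 2^-1 = 2 / K * (2 / e ^+ 2).
    by field; rewrite !gt_eqF.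
  apply: ler_wpM2l; first by rewrite divr_ge0// ltW.
  rewrite ler_pdivrMr; last lra.
  apply: le_trans (cos_max _) _.
  rewrite mulrAC ler_pdivlMr ?exprn_gt0// expr2; nra.
have -> : cos_series_defect M t = w t - 2 / K * (cos (K * pi * t) / sin (pi * t)).
  by rewrite /w addrK.
apply: le_trans (ler_normB _ _) _; lra.
Qed.

Lemma cos_series_sym (R : realType) (M : nat) (t : R) : cos_series M (1 - t) = cos_series M t.
Proof.
apply: eq_bigr => h _; congr (_ / _).
rewrite -(cosN (2 * pi * h%:R * t)) -[RHS](_ : cos (2 * pi * (- h%:R * t + h%:Z%:~R)) = _).
  by congr cos; rewrite /=; ring.
by rewrite cos_shift; congr cos; ring.
Qed.

(** The summand is h^(-3/2) without real powers; it is at most 2/sqrt(h-1) - 2/sqrt(h), so the sum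
    telescopes. This series is also the majorant for the later sums over k. *)
Lemma sum_inv_sqrt3 (R : realType) (A B : nat) : (0 < A <= B)%N ->
  \sum_(A.+1 <= h < B.+1) Num.sqrt h%:R / h%:R ^+ 2
    <= 2 / Num.sqrt A%:R - 2 / Num.sqrt B%:R :> R.
Proof.
move=> /andP[A0]; elim: B => [|B IH]; first by rewrite leqn0 => /eqP A1; rewrite A1 in A0.
rewrite leq_eqVlt => /orP[/eqP ->|]; first by rewrite big_geq// subrr.
rewrite ltnS => AB; rewrite big_nat_recr/=; last by rewrite ltnS.
have B0 : (0 < B)%N := leq_trans A0 AB.
set q : R := Num.sqrt B.+1%:R; set r : R := Num.sqrt B%:R.
have r0 : 0 < r by rewrite sqrtr_gt0 ltr0n.
have q0 : 0 < q by rewrite sqrtr_gt0 ltr0n.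
have qr : r <= q by rewrite ler_sqrt ?ler_nat ?ltr0n.
have q2 : q ^+ 2 = B.+1%:R by rewrite sqr_sqrtr ?ler0n.
have r2 : r ^+ 2 = B%:R by rewrite sqr_sqrtr ?ler0n.
suff : q / B.+1%:R ^+ 2 <= 2 / r - 2 / q 
  by move=> h; apply: le_trans (lerD (IH AB) h) _; rewrite -/r; lra.
have hqr : q ^+ 2 - r ^+ 2 = 1 by rewrite q2 r2 -natr1; ring.
rewrite -q2 -subr_ge0.
have -> : 2 / r - 2 / q - q / (q ^+ 2) ^+ 2 =
   (2 * q ^+ 2 * (q - r) - r) / (r * q ^+ 3) by field; rewrite !gt_eqF.
rewrite divr_ge0//; last by rewrite mulr_ge0 ?exprn_ge0// ltW.
have : (q - r) * (q + r) = 1 by rewrite -hqr; ring.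
have : 0 <= q - r by rewrite subr_ge0.
move: (q - r) => d d0 hd.
have : d * (q * q) *2 >= d * ((q + r) * q) by rewrite -mulrA; apply: ler_wpM2l => //; nra.
by rewrite mulrA hd expr2; nra.
Qed.

Lemma sum_inv_sqrt (R : realType) (B : nat) :
  \sum_(1 <= h < B.+1) Num.sqrt h%:R / h%:R <= 2 * Num.sqrt B%:R :> R.
Proof.
elim: B => [|B IH]; first by rewrite big_geq// sqrtr0 mulr0.
rewrite big_nat_recr//=.
set q : R := Num.sqrt B.+1%:R; set r : R := Num.sqrt B%:R.
have r0 : 0 <= r by rewrite sqrtr_ge0.
have q0 : 0 < q by rewrite sqrtr_gt0 ltr0n.
have qr : r <= q by rewrite ler_sqrt ?ler_nat ?ltr0n.
have q2 : q ^+ 2 = B.+1%:R by rewrite sqr_sqrtr ?ler0n.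
have r2 : r ^+ 2 = B%:R by rewrite sqr_sqrtr ?ler0n.
suff : q / B.+1%:R <= 2 * q - 2 * r 
  by move=> h; apply: le_trans (lerD IH h) _; rewrite -/r; lra.
have hqr : q ^+ 2 - r ^+ 2 = 1 by rewrite q2 r2 -natr1; ring.
rewrite ler_pdivrMr ?ltr0n// -q2.
have : (q - r) * (q + r) = 1 by rewrite -hqr; ring.
have : 0 <= q - r by rewrite subr_ge0.
rewrite -mulrBr; move: (q - r) => d d0 hd.
have : d * (q * 2) >= d * (q + r) by apply: ler_wpM2l => //; lra.
rewrite expr2; nra.
Qed.

Lemma sum_inv_sqrt3_le3 (R : realType) (B : nat) :
  \sum_(1 <= h < B.+1) Num.sqrt h%:R / h%:R ^+ 2 <= 3 :> R.
Proof.
case: B => [|B]; first by rewrite big_geq.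
rewrite big_ltn//.
have := @sum_inv_sqrt3 R 1 B.+1 isT; rewrite sqrtr1 expr1n.
have : 0 <= 2 / Num.sqrt B.+1%:R :> R by rewrite divr_ge0// sqrtr_ge0.
lra.
Qed.

Definition saw (R : realType) (t : R) : R := t - (Num.floor t)%:~R - 2^-1.

(** Twice a continuous 1-periodic primitive of [saw]. *)
Definition frac_parabola (R : realType) (t : R) : R :=
  (t - (Num.floor t)%:~R) ^+ 2 - (t - (Num.floor t)%:~R).

Lemma cos_series_shift (R : realType) (M : nat) (t : R) (k : int) :
  cos_series M (t + k%:~R) = cos_series M t.
Proof.
apply: eq_bigr => h _; congr (_ / _).
rewrite -[2 * pi * h%:R * t]mulrA -(cos_shift (h%:R * t) (h%:Z * k)).
by congr cos; rewrite intrM; ring.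
Qed.

Lemma cos_scale_lipschitz (R : realType) (a s t : R) : 0 <= a -> s <= t ->
  `|cos (a * t) - cos (a * s)| <= a * (t - s).
Proof.
move=> a0 st.
apply: (@lipschitz_of_deriv R (fun u => cos (a * u)) (fun u => - a * sin (a * u))) => // [u _|u _].
  exact: is_derive_cos_scale.
by rewrite normrM normrN (ger0_norm a0); have := sin_max (a * u); nra.
Qed.

(* Each increment of the cosine is at most min(2, 8 h s^2) <= 4 s sqrt h. *)
Lemma cos_series_near0 (R : realType) (M : nat) (s t : R) :
  0 < s -> 0 <= t <= s ^+ 2 -> `|cos_series M (s ^+ 2) - cos_series M t| <= 12 * s.
Proof.
move=> s0 /andP[t0 ts]; rewrite /cos_series -sumrB.
apply: le_trans (ler_norm_sum _ _ _) _.
apply: (@le_trans _ _ (\sum_(1 <= h < M.+1) 4 * s * (Num.sqrt h%:R / h%:R ^+ 2))); last first.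
  by rewrite -big_distrr/=; have := @sum_inv_sqrt3_le3 R M; nra.
apply: ler_sum_nat => h /andP[h0 _].
rewrite -mulrBl normrM normfV (ger0_norm (x := h%:R ^+ 2)) ?sqr_ge0//.
rewrite [4 * s * (_ / _)]mulrA.
apply: ler_wpM2r; first by rewrite invr_ge0 sqr_ge0.
set r := Num.sqrt h%:R; have r0 : 0 <= r by rewrite sqrtr_ge0.
have r2 : r ^+ 2 = h%:R by rewrite sqr_sqrtr ?ler0n.
have b1 : `|cos (2 * pi * h%:R * s ^+ 2) - cos (2 * pi * h%:R * t)| <= 8 * (s * r) ^+ 2.
  apply: le_trans (cos_scale_lipschitz _ ts) _.
    by rewrite !mulr_ge0// pi_ge0.
  rewrite exprMn r2.
  have hp := pi_lt4 R; have hp0 := pi_gt0 R; have h1 := ler0n R h.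
  have : 2 * pi * h%:R * (s ^+ 2 - t) <= 2 * pi * h%:R * s ^+ 2.
    by apply: ler_wpM2l; [rewrite !mulr_ge0// ltW|lra].
  have : (4 - pi) * (h%:R * s ^+ 2) >= 0 by rewrite !mulr_ge0 ?sqr_ge0//; lra.
  lra.
have b2 : `|cos (2 * pi * h%:R * s ^+ 2) - cos (2 * pi * h%:R * t)| <= 2.
  apply: le_trans (ler_normB _ _) _.
  have := cos_max (2 * pi * h%:R * s ^+ 2); have := cos_max (2 * pi * h%:R * t); lra.
have w0 : 0 <= s * r by rewrite mulr_ge0// ltW.
have -> : 4 * s * r = 4 * (s * r) by ring.
have [hw|hw] := lerP (s * r) 2^-1; last by lra.
apply: le_trans b1 _; rewrite expr2; nra.
Qed.

(** The derivative of the difference E is controlled only away from the integers. Within e of an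
    integer, the parabola and the series are instead shown separately to vary little. The constant
    [c] is just the value at 1/2 and is never identified, because only differences of
    [frac_parabola] are used. *)
Lemma frac_parabola_fourier (R : realType) (L : nat) : (0 < L)%N ->
  exists (M : nat) (c : R), forall t : R,
    `|frac_parabola t - (c + cos_series M t / pi ^+ 2)| <= 12 / L%:R.
Proof.
move=> L0; set s : R := L%:R^-1.
have l1 : 1 <= L%:R :> R by rewrite ler1n.
have s0 : 0 < s by rewrite invr_gt0 ltr0n.
have s1 : s <= 1 by rewrite /s invf_le1//; lra.
have hp := pi_lt4 R; have hp2 := pi_ge2 R.
(* [cos_series_near0] loses the square root of the width of the strip, so a width of order s^2 gives
   an error of order s. *)
pose e := s ^+ 2 / 2.
have e0 : 0 < e by rewrite divr_gt0// exprn_gt0.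
(* Exactly what makes the defect bound D on [e, 1 - e] at most s/4. *)
have [M hM] : exists M : nat, 32 / (e ^+ 2 * s) <= M%:R.
  by exists (Num.bound (32 / (e ^+ 2 * s))); apply/ltW/archi_boundP;
     rewrite divr_ge0// mulr_ge0 ?sqr_ge0// ltW.
pose E (u : R) := pi ^+ 2 * (u ^+ 2 - u) - cos_series M u.
exists M, (E 2^-1 / pi ^+ 2).
set D := 8 / (M.*2.+1%:R * e ^+ 2).
have D0 : 0 <= D by rewrite divr_ge0// mulr_ge0 ?sqr_ge0.
have Ds : D <= s / 4.
  rewrite ler_pdivrMr ?mulr_gt0 ?exprn_gt0//.
  have : M%:R <= M.*2.+1%:R :> R by rewrite ler_nat -addnn; lia.
  move: hM; rewrite ler_pdivrMr ?mulr_gt0 ?exprn_gt0//.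
  move: (M.*2.+1%:R) (M%:R) => K m h1 h2.
  have : (K - m) * (e ^+ 2 * s) >= 0 by apply: mulr_ge0; [lra|rewrite mulr_ge0 ?sqr_ge0// ltW].
  lra.
have pid : 0 <= pi * D by rewrite mulr_ge0// ltW//; lra.
have mid (u : R) : e <= u <= 1 - e -> `|E u - E 2^-1| <= pi * D.
  move=> hu; have bnd (v : R) : e <= v <= 1 - e -> `|pi * cos_series_defect M v| <= pi * D.
    move=> hv; rewrite normrM (ger0_norm (x := pi)); last lra.
    by rewrite ler_wpM2l ?cos_series_defect_bound//; lra.
  have [ul|ug] := lerP u 2^-1.
    rewrite distrC; apply: le_trans
      (@lipschitz_of_deriv R E (fun v => pi * cos_series_defect M v) u 2^-1 (pi * D) ul _ _) _.
    - by move=> x _; exact: is_derive_parabola_sub_cos_series.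
    - by move=> x hx; apply: bnd; lra.
    - by apply: (le_trans (ler_wpM2l pid (y := 1) _)); [lra|rewrite mulr1].
  apply: le_trans
      (@lipschitz_of_deriv R E (fun v => pi * cos_series_defect M v) 2^-1 u (pi * D) (ltW ug) _ _) _.
  - by move=> x _; exact: is_derive_parabola_sub_cos_series.
  - by move=> x hx; apply: bnd; lra.
  - by apply: (le_trans (ler_wpM2l pid (y := 1) _)); [lra|rewrite mulr1].
have low (u : R) : 0 <= u <= 2^-1 -> `|E u - E 2^-1| <= pi * D + 32 * s.
  move=> hu; have [ul|ug] := lerP e u.
    apply: (@le_trans _ _ (pi * D)); [|lra].
    by apply: mid; rewrite ?ul/=; have : e <= 2^-1; rewrite /e ?expr2; nra.
  have ss1 : s ^+ 2 <= s by rewrite expr2; nra.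
  (* [cos_series_near0] compares only with the value at s^2, so going from u to e passes through s^2
     and costs 24 s; the parabola adds 8 s, hence 32 s in all. *)
  have h1 : `|cos_series M (s ^+ 2) - cos_series M u| <= 12 * s.
    by apply: cos_series_near0 => //; move: ug e0; rewrite /e; lra.
  have h2 : `|cos_series M (s ^+ 2) - cos_series M e| <= 12 * s.
    by apply: cos_series_near0 => //; move: ug e0; rewrite /e; lra.
  have e12 : e <= 2^-1 by rewrite /e; lra.
  have h3 := mid e ltac:(by apply/andP; split; lra).
  have h4 : `|pi ^+ 2 * (u ^+ 2 - u) - pi ^+ 2 * (e ^+ 2 - e)| <= 8 * s.
    have -> : pi ^+ 2 * (u ^+ 2 - u) - pi ^+ 2 * (e ^+ 2 - e) =
      pi ^+ 2 * ((e - u) * (1 - (u + e))) by ring.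
    have c0 : 0 <= (e - u) * (1 - (u + e)) by rewrite mulr_ge0//; lra.
    have c1 : (e - u) * (1 - (u + e)) <= e.
      have : 0 <= (e - u) * (u + e) by rewrite mulr_ge0//; lra.
      lra.
    have p16 : pi ^+ 2 <= 16 :> R by rewrite expr2; nra.
    rewrite ger0_norm; last by rewrite mulr_ge0 ?sqr_ge0.
    have e8 : 16 * e <= 8 * s by rewrite /e; lra.
    by apply: le_trans (ler_pM (sqr_ge0 pi) c0 p16 c1) e8.
  have -> : E u - E 2^-1 = (E e - E 2^-1) + (pi ^+ 2 * (u ^+ 2 - u) - pi ^+ 2 * (e ^+ 2 - e))
     + (cos_series M (s ^+ 2) - cos_series M u) - (cos_series M (s ^+ 2) - cos_series M e) by rewrite /E; ring.
  move: h1 h2 h3 h4; rewrite !ler_norml; lra.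
have all01 (u : R) : 0 <= u <= 1 -> `|E u - E 2^-1| <= 33 * s.
  move=> hu; have b0 : pi * D + 32 * s <= 33 * s.
    by have := ler_pM (pi_ge0 R) D0 (ltW hp) Ds; lra.
  apply: (le_trans _ b0); have [ul|ug] := lerP u 2^-1; first by apply: low; lra.
  have -> : E u = E (1 - u) by rewrite /E cos_series_sym; ring.
  by apply: low; lra.
move=> t; set u := t - (Num.floor t)%:~R.
have hu : 0 <= u <= 1.
  by have := Num.Theory.floor_itv t; rewrite /u intrD; lra.
have -> : cos_series M t = cos_series M u by rewrite -(cos_series_shift M u (Num.floor t)) /u subrK.
rewrite /frac_parabola -/u.
have p0 : 0 < pi ^+ 2 :> R by rewrite exprn_gt0//; lra.
have p4 : 4 <= pi ^+ 2 :> R by rewrite expr2; nra.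
have -> : u ^+ 2 - u - (E 2^-1 / pi ^+ 2 + cos_series M u / pi ^+ 2) =
   (E u - E 2^-1) / pi ^+ 2.
  move: (E 2^-1) => v; rewrite /E; clear -hp2.
  by field; rewrite gt_eqF//; lra.
rewrite normrM normfV (ger0_norm (ltW p0)) ler_pdivrMr//.
apply: le_trans (all01 u hu) _; rewrite -/s; nra.
Qed.

(** * From the sawtooth to exponential sums *)

(** The sawtooth has slope 1 and jumps only downwards, so saw t <= saw u + (t - u) for u <= t.
    Integrating over u in [t - d, t] gives the bound, half of [frac_parabola] being a primitive;
    [saw_ge] integrates over [t, t + d]. The proof checks the inequality according to whether the
    interval meets an integer. *)
Lemma saw_le (R : realType) (d t : R) : 0 < d <= 1 ->
  d * saw t <= (frac_parabola t - frac_parabola (t - d)) / 2 + d ^+ 2 / 2.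
Proof.
move=> d01; have := Num.Theory.floor_itv t; rewrite intrD /frac_parabola /saw.
set k := Num.floor t => hu; have [du|ud] := lerP d (t - k%:~R).
  have -> : Num.floor (t - d) = k.
    by apply: Num.Theory.floor_def; rewrite intrD; lra.
  lra.
have -> : Num.floor (t - d) = k - 1.
  by apply: Num.Theory.floor_def; rewrite !intrD mulrNz; lra.
rewrite intrD mulrNz; set u := t - k%:~R in hu ud *.
have -> : t - d - (k%:~R + - 1%:~R) = u - d + 1 by rewrite /u; ring.
move: hu ud; rewrite -/u => hu ud; lra.
Qed.

Lemma saw_ge (R : realType) (d t : R) : 0 < d <= 1 ->
  (frac_parabola (t + d) - frac_parabola t) / 2 - d ^+ 2 / 2 <= d * saw t.
Proof.
move=> d01; have := Num.Theory.floor_itv t; rewrite intrD /frac_parabola /saw.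
set k := Num.floor t => hu; have [du|ud] := ltrP (t - k%:~R + d) 1.
  have -> : Num.floor (t + d) = k.
    by apply: Num.Theory.floor_def; rewrite intrD; lra.
  lra.
have -> : Num.floor (t + d) = k + 1.
  by apply: Num.Theory.floor_def; rewrite !intrD; lra.
rewrite intrD; set u := t - k%:~R in hu ud *.
have -> : t + d - (k%:~R + 1%:~R) = u + d - 1 by rewrite /u; ring.
move: hu ud; rewrite -/u => hu ud; lra.
Qed.

Lemma norm_sin_le (R : realType) (x : R) : 0 <= x -> `|sin x| <= x.
Proof.
move=> x0; have := @lipschitz_of_deriv R sin cos 0 x 1 x0.
rewrite sin0 !subr0 mul1r; by apply=> u _; exact: cos_max.
Qed.

(* Size of the h-th Fourier coefficient of the sawtooth averaged over length 1/H. *)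
Definition fourier_weight (R : realType) (H h : nat) : R := Num.min h%:R^-1 (H%:R / h%:R ^+ 2).

Lemma frac_parabola_sum_bound (R : realType) (f U : nat -> R) (a : R) (m p H M : nat) (c : R) :
  (m <= p)%N -> (0 < H)%N ->
  (forall t : R, `|frac_parabola t - (c + cos_series M t / pi ^+ 2)| <= 12 / (H ^ 2)%:R) ->
  (forall (h : nat) (phi : R), (0 < h)%N ->
     `|\sum_(m <= n < p) cos (2 * pi * (h%:R * f n + phi))| <= U h) ->
  `|\sum_(m <= n < p) (frac_parabola (f n + a) - frac_parabola (f n + a - H%:R^-1))| <=
    24 * (p - m)%N%:R / H%:R ^+ 2 + 2 / H%:R * \sum_(1 <= h < M.+1) fourier_weight R H h * U h.
Proof.
move=> mp H0 hF hU; set d : R := H%:R^-1.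
have Hp : 0 < H%:R :> R by rewrite ltr0n.
have d0 : 0 < d by rewrite invr_gt0.
have hp0 := pi_gt0 R; have hp2 := pi_ge2 R.
pose er t := frac_parabola t - (c + cos_series M t / pi ^+ 2).
have -> : \sum_(m <= n < p) (frac_parabola (f n + a) - frac_parabola (f n + a - d)) =
   \sum_(m <= n < p) (er (f n + a) - er (f n + a - d)) +
   (\sum_(m <= n < p) (cos_series M (f n + a) - cos_series M (f n + a - d))) / pi ^+ 2.
  rewrite mulr_suml -big_split/=; apply: eq_bigr => n _; rewrite /er.
  have : pi ^+ 2 != 0 :> R by rewrite expf_neq0// gt_eqF.
  by move: (pi ^+ 2) => q q0; field.
apply: le_trans (ler_normD _ _) _; apply: lerD.
  apply: le_trans (ler_norm_sum _ _ _) _.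
  apply: (@le_trans _ _ (\sum_(m <= n < p) (24 / H%:R ^+ 2))).
    apply: ler_sum => n _; apply: le_trans (ler_normB _ _) _.
    have := hF (f n + a); have := hF (f n + a - d); rewrite natrX -!/(er _).
    lra.
  by rewrite sumr_const_nat -mulr_natr; lra.
rewrite normrM normfV (ger0_norm (x := pi ^+ 2)) ?sqr_ge0//.
rewrite ler_pdivrMr ?exprn_gt0//.
(* With x = pi h d this is cos A - cos(A - 2x) = -2 sin x sin(A - x). The phase -1/4 rewrites the
   last sine as a cosine, so that the hypothesis on cosine sums with arbitrary phase applies. *)
have -> : \sum_(m <= n < p) (cos_series M (f n + a) - cos_series M (f n + a - d)) =
   \sum_(1 <= h < M.+1) (- 2 * sin (pi * h%:R * d) / h%:R ^+ 2 *
     \sum_(m <= n < p) cos (2 * pi * (h%:R * f n + (h%:R * a - h%:R * d / 2 - 4^-1)))).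
  under eq_bigr do rewrite -sumrB.
  rewrite exchange_big/=; apply: eq_bigr => h _; rewrite big_distrr/=.
  apply: eq_bigr => n _; rewrite -mulrBl [RHS]mulrAC; congr (_ / _).
  set x := pi * h%:R * d.
  have -> : 2 * pi * (h%:R * f n + (h%:R * a - h%:R * d / 2 - 4^-1)) =
    2 * pi * h%:R * (f n + a) - x - pi / 2 by rewrite /x; field.
  rewrite cosBpihalf.
  have -> : 2 * pi * h%:R * (f n + a - d) = 2 * pi * h%:R * (f n + a) - x - x by rewrite /x; ring.
  have -> : 2 * pi * h%:R * (f n + a) = 2 * pi * h%:R * (f n + a) - x + x by ring.
  rewrite addrK; move: (_ - x) => y; rewrite cosB cosD; ring.
apply: le_trans (ler_norm_sum _ _ _) _.
rewrite [leRHS]mulrC mulrA mulr_sumr; apply: ler_sum_nat => h /andP[h0 _].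
have hp : 0 < h%:R :> R by rewrite ltr0n.
rewrite normrM [leRHS]mulrA.
apply: ler_pM => //; last exact: hU.
rewrite normrM normfV (ger0_norm (x := h%:R ^+ 2)) ?sqr_ge0// normrM normrN (ger0_norm (x := 2))//.
rewrite ler_pdivrMr ?exprn_gt0//.
(* The two bounds 1 and pi h d for the sine correspond to the two arguments of the minimum in
   [fourier_weight]. *)
have s1 := sin_max (pi * h%:R * d).
have s2 : `|sin (pi * h%:R * d)| <= pi * h%:R * d.
  by apply: norm_sin_le; rewrite !mulr_ge0// ltW.
rewrite /fourier_weight; case: (lerP h%:R^-1 _) => _.
  apply: (@le_trans _ _ (2 * (pi * h%:R * d))); first by apply: ler_wpM2l.
  have -> : pi ^+ 2 * (2 / H%:R) * h%:R^-1 * h%:R ^+ 2 = 2 * (pi * h%:R * d) * pi.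
    by rewrite /d; set q : R := pi; clearbody q; field; rewrite !gt_eqF.
  have : 0 <= 2 * (pi * h%:R * d) by rewrite !mulr_ge0// ltW.
  by move: (2 * (pi * _ * _)) => z; nra.
have -> : pi ^+ 2 * (2 / H%:R) * (H%:R / h%:R ^+ 2) * h%:R ^+ 2 = 2 * pi ^+ 2 :> R.
  by set q : R := pi; clearbody q; field; rewrite !gt_eqF.
have : 1 <= pi ^+ 2 :> R by rewrite expr2; nra.
lra.
Qed.

(** Since the squeeze divides by d = 1/H, the Fourier approximation is taken with precision H^2. Its
    error contributes 12 and the squeeze 1/2 to the constant, rounded up to 13. *)
Lemma saw_sum_bound (R : realType) (f U : nat -> R) (m p H : nat) :
  (m <= p)%N -> (0 < H)%N ->
  (forall (h : nat) (phi : R), (0 < h)%N ->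
     `|\sum_(m <= n < p) cos (2 * pi * (h%:R * f n + phi))| <= U h) ->
  exists M : nat, `|\sum_(m <= n < p) saw (f n)| <=
    13 * (p - m)%N%:R / H%:R + \sum_(1 <= h < M.+1) fourier_weight R H h * U h.
Proof.
move=> mp H0 hU; have [M [c hF]] := @frac_parabola_fourier R (H ^ 2) ltac:(by rewrite expn_gt0 H0).
exists M; set d : R := H%:R^-1.
have Hp : 0 < H%:R :> R by rewrite ltr0n.
have H1 : 1 <= H%:R :> R by rewrite ler1n.
have d0 : 0 < d by rewrite invr_gt0.
have d01 : 0 < d <= 1 by rewrite d0/= invf_le1.
have N0 : 0 <= (p - m)%N%:R :> R by [].
have B0 := @frac_parabola_sum_bound R f U 0 m p H M c mp H0 hF hU.
have B1 := @frac_parabola_sum_bound R f U d m p H M c mp H0 hF hU.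
set S := \sum_(m <= n < p) saw (f n).
set V := \sum_(1 <= h < M.+1) _ in B0 B1 *.
have u0 : d * S <= (\sum_(m <= n < p) (frac_parabola (f n + 0) - frac_parabola (f n + 0 - d))) / 2
    + (p - m)%N%:R * (d ^+ 2 / 2).
  rewrite big_distrr mulr_suml -sumr_const_nat mulr_suml -big_split/=.
  by apply: ler_sum => n _; rewrite mul1r addr0; exact: saw_le.
have u1 : (\sum_(m <= n < p) (frac_parabola (f n + d) - frac_parabola (f n + d - d))) / 2
    - (p - m)%N%:R * (d ^+ 2 / 2) <= d * S.
  rewrite big_distrr mulr_suml -sumr_const_nat mulr_suml -sumrB/=.
  by apply: ler_sum => n _; rewrite mul1r addrK; exact: saw_ge.
suff : `|d * S| <= d * (13 * (p - m)%N%:R / H%:R + V).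
  by rewrite normrM (ger0_norm (ltW d0)) ler_pM2l.
have e1 : 24 * (p - m)%N%:R / H%:R ^+ 2 = 24 * (p - m)%N%:R * d ^+ 2 by rewrite exprVn.
rewrite -/d in B0 B1 *; rewrite e1 in B0 B1; move: B0 B1 u0 u1.
have : 0 <= (p - m)%N%:R * d ^+ 2 by rewrite mulr_ge0 ?sqr_ge0.
rewrite !ler_norml; lra.
Qed.

(** * Sawtooth sums along y / n^b *)

(** Discrete form of the bound b t^(-b-1) for the derivative of t^-b, by induction on b with the
    product rule. *)
Lemma inv_pow_diff_le (R : realType) (b n : nat) : (0 < n)%N ->
  (n%:R ^+ b)^-1 - (n.+1%:R ^+ b)^-1 <= b%:R / n%:R ^+ b.+1 :> R.
Proof.
move=> n0; have np : 0 < n%:R :> R by rewrite ltr0n.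
elim: b => [|b IH]; first by rewrite !expr0 mul0r subrr.
set x : R := n%:R in np IH *; set z : R := n.+1%:R in IH *.
have zx : z = x + 1 by rewrite /z -natr1.
have zp : 0 < z by rewrite ltr0n.
have -> : (x ^+ b.+1)^-1 - (z ^+ b.+1)^-1 =
   (((x ^+ b)^-1 - (z ^+ b)^-1) + (z ^+ b)^-1 / z) / x.
  rewrite !exprS zx; field; rewrite -zx !expf_neq0 ?gt_eqF//.
have zb : (z ^+ b)^-1 <= (x ^+ b)^-1.
  rewrite lef_pV2 ?posrE ?exprn_gt0//; apply: lerXn2r; rewrite ?nnegrE ?ltW//; lra.
have zb2 : (z ^+ b)^-1 / z <= (x ^+ b.+1)^-1.
  rewrite exprSr invfM; apply: ler_pM => //; rewrite ?invr_ge0 ?exprn_ge0 ?ltW//.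
  by rewrite ltf_pV2//; lra.
have -> : b.+1%:R / x ^+ b.+2 = (b%:R / x ^+ b.+1 + (x ^+ b.+1)^-1) / x.
  by rewrite [x ^+ b.+2]exprSr -(natr1 b); field; rewrite !expf_neq0 ?gt_eqF.
by apply: ler_wpM2r; [rewrite invr_ge0 ltW|exact: lerD].
Qed.

(** The matching lower bound, evaluated at the right end and without the factor b. It separates
    increments from 0 and also telescopes the tail of the zeta series. *)
Lemma inv_pow_diff_ge (R : realType) (b n : nat) : (0 < n)%N -> (0 < b)%N ->
  (n.+1%:R ^+ b.+1)^-1 <= (n%:R ^+ b)^-1 - (n.+1%:R ^+ b)^-1 :> R.
Proof.
move=> n0; have np : 0 < n%:R :> R by rewrite ltr0n.
set x : R := n%:R in np *; set z : R := n.+1%:R.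
have zx : z = x + 1 by rewrite /z -natr1.
have zp : 0 < z by rewrite ltr0n.
case: b => // b _; rewrite -subr_ge0.
have -> : (x ^+ b.+1)^-1 - (z ^+ b.+1)^-1 - (z ^+ b.+2)^-1 =
   ((x ^+ b)^-1 * (z ^+ 2 / x) - (z ^+ b)^-1 * (z + 1)) / z ^+ 2.
  rewrite !exprS zx expr0; field; rewrite -zx !expf_neq0 ?gt_eqF//.
rewrite divr_ge0 ?sqr_ge0// subr_ge0; apply: ler_pM.
- by rewrite invr_ge0 exprn_ge0// ltW.
- lra.
- rewrite lef_pV2 ?posrE ?exprn_gt0//; apply: lerXn2r; rewrite ?nnegrE ?ltW//; lra.
- by rewrite ler_pdivlMr// zx expr2; lra.
Qed.

(** Induction on b through the Leibniz rule for the second difference of n^-b times n^-1. All its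
    terms are nonnegative, so the one carrying the induction hypothesis suffices. *)
Lemma inv_pow_diff2_ge (R : realType) (b n : nat) : (0 < n)%N -> (0 < b)%N ->
  (n.+2%:R ^+ b.+2)^-1 <=
    (n%:R ^+ b)^-1 - 2 * (n.+1%:R ^+ b)^-1 + (n.+2%:R ^+ b)^-1 :> R.
Proof.
move=> n0; have np : 0 < n%:R :> R by rewrite ltr0n.
set x : R := n%:R in np *; set z : R := n.+1%:R; set v : R := n.+2%:R.
have zx : z = x + 1 by rewrite /z -natr1.
have vx : v = x + 2 by rewrite /v -(natr1 n.+1) -natr1; ring.
have zp : 0 < z by rewrite ltr0n.
have vp : 0 < v by rewrite ltr0n.
have iv (p q : R) : 0 < p -> p <= q -> q^-1 <= p^-1.
  by move=> p0 pq; rewrite lef_pV2// posrE; lra.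
case: b => // b _; elim: b => [|b IH].
  have -> : (x ^+ 1)^-1 - 2 * (z ^+ 1)^-1 + (v ^+ 1)^-1 = 2 / (x * z * v).
    by rewrite !expr1 vx zx; field; rewrite -zx -vx !gt_eqF.
  apply: (@le_trans _ _ (x * z * v)^-1).
    apply: iv; first by rewrite !mulr_gt0.
    rewrite exprSr; apply: ler_pM; [by rewrite mulr_ge0// ltW|lra| |lra].
    by rewrite expr2; apply: ler_pM; lra.
  have q0 : 0 <= (x * z * v)^-1 by rewrite invr_ge0 !mulr_ge0// ltW.
  by move: (x * z * v)^-1 q0 => q q0; lra.
have mono (p q : R) : 0 < p -> p <= q -> (q ^+ b.+1)^-1 <= (p ^+ b.+1)^-1.
  move=> p0 pq; apply: iv; first exact: exprn_gt0.
  by apply: lerXn2r; rewrite ?nnegrE; lra.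
have m1 := mono x z np ltac:(lra); have m2 := mono z v zp ltac:(lra).
have i1 := iv x z np ltac:(lra); have i2 := iv z v zp ltac:(lra).
have cv : 0 <= x^-1 - 2 * z^-1 + v^-1.
  have -> : x^-1 - 2 * z^-1 + v^-1 = 2 / (x * z * v).
    by rewrite vx zx; field; rewrite -zx -vx !gt_eqF.
  by rewrite divr_ge0// !mulr_ge0// ltW.
have e (u : R) k : (u ^+ k.+1)^-1 = (u ^+ k)^-1 * u^-1 by rewrite exprSr invfM.
rewrite (e x b.+1) (e z b.+1) (e v b.+3) (e v b.+1).
have q0 : 0 <= (v ^+ b.+3)^-1 by rewrite invr_ge0 exprn_ge0// ltW.
have zg : 0 <= (z ^+ b.+1)^-1 by rewrite invr_ge0 exprn_ge0// ltW.
have vz : 0 <= v^-1 by rewrite invr_ge0 ltW.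
move: IH m1 m2 i1 i2 cv q0 zg vz.
move: (v ^+ b.+3)^-1 (x ^+ b.+1)^-1 (z ^+ b.+1)^-1 (v ^+ b.+1)^-1 x^-1 z^-1 v^-1.
move=> q X Z V xi zi vi IH m1 m2 i1 i2 cv q0 zg vz.
(* With a = X - Z, d = Z - V, c = xi - zi, e = zi - vi, the second difference of the
   product is Z (c - e) + zi (a - d) + a c + d e. *)
have a0 : 0 <= (X - Z) * (xi - zi) by rewrite mulr_ge0//; lra.
have a1 : 0 <= (Z - V) * (zi - vi) by rewrite mulr_ge0//; lra.
have a2 : 0 <= Z * (xi - 2 * zi + vi) by rewrite mulr_ge0.
have a3 : q * vi <= (X - 2 * Z + V) * zi by apply: ler_pM.
lra.
Qed.

(** Split at h = H: below, the weight 1/h gives 2 sqrt H; above, the weight H/h^2 gives H times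
    2/sqrt H. *)
Lemma sum_fourier_weight (R : realType) (H M : nat) : (0 < H)%N ->
  \sum_(1 <= h < M.+1) fourier_weight R H h * Num.sqrt h%:R <= 4 * Num.sqrt H%:R.
Proof.
move=> H0; have Hp : 0 < H%:R :> R by rewrite ltr0n.
have s0 : 0 < Num.sqrt H%:R :> R by rewrite sqrtr_gt0.
have w1 h : fourier_weight R H h * Num.sqrt h%:R <= Num.sqrt h%:R / h%:R.
  by rewrite mulrC; apply: ler_wpM2l; rewrite ?sqrtr_ge0// /fourier_weight ge_min lexx.
have w2 h : fourier_weight R H h * Num.sqrt h%:R <= H%:R * (Num.sqrt h%:R / h%:R ^+ 2).
  rewrite mulrCA mulrC; apply: ler_wpM2l; rewrite ?sqrtr_ge0// /fourier_weight ge_min.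
  by rewrite lexx orbT.
have lo K : (K <= H)%N ->
    \sum_(1 <= h < K.+1) fourier_weight R H h * Num.sqrt h%:R <= 2 * Num.sqrt H%:R.
  move=> KH; apply: le_trans (ler_sum_nat _) _ => [h _|]; first exact: w1.
  apply: le_trans (sum_inv_sqrt R K) _; apply: ler_wpM2l => //.
  by rewrite ler_wsqrtr// ler_nat.
have [MH|HM] := leqP M H; first by apply: le_trans (lo _ MH) _; lra.
rewrite (big_cat_nat (n := H.+1))//=; last by rewrite ltnS ltnW.
have := lo H (leqnn H).
have : \sum_(H.+1 <= h < M.+1) fourier_weight R H h * Num.sqrt h%:R <= 2 * Num.sqrt H%:R.
  apply: le_trans (ler_sum_nat _) _ => [h _|]; first exact: w2.
  rewrite -big_distrr/=.
  have := @sum_inv_sqrt3 R H M ltac:(by rewrite H0 ltnW).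
  have q0 : 0 <= 2 / Num.sqrt M%:R :> R by rewrite divr_ge0// sqrtr_ge0.
  move=> h; apply: (@le_trans _ _ (H%:R * (2 / Num.sqrt H%:R))).
    by apply: ler_wpM2l; [exact: ltW|lra].
  by rewrite mulrCA ler_wpM2l// ler_pdivrMr// -expr2 sqr_sqrtr// ltW.
lra.
Qed.

(** Inside a block ending at X one has n + 2 <= 3 X, so inverse powers up to exponent b + 2 lose at
    most this factor against those of X. *)
Definition separation_cst (R : realType) (b : nat) : R := (3 ^+ b.+2)^-1.

Lemma inv_pow_steps (R : realType) (b X m p n : nat) (y : R) :
  (0 < b)%N -> 0 < y -> (0 < m)%N -> (p <= X.+1)%N -> (X <= m.*2)%N ->
  (m <= n < p)%N ->
  let L := y / X%:R ^+ b.+1 in let f k := y / k%:R ^+ b in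
  [/\ separation_cst R b * L <= f n - f n.+1,
      f n - f n.+1 <= b%:R * 2 ^+ b.+1 * L &
      separation_cst R b * L / X%:R <= f n - 2 * f n.+1 + f n.+2].
Proof.
move=> b0 y0 m0 pX Xm /andP[mn np] L f.
have n0 : (0 < n)%N by exact: leq_trans mn.
have nX : (n <= X)%N by rewrite -ltnS (leq_trans np).
have X0 : (0 < X)%N by exact: leq_trans nX.
have Xp : 0 < X%:R :> R by rewrite ltr0n.
have mon (u v k : nat) : (0 < u)%N -> (u <= v)%N -> (v%:R ^+ k)^-1 <= (u%:R ^+ k)^-1 :> R.
  move=> u0 uv; rewrite lef_pV2 ?posrE ?exprn_gt0 ?ltr0n//; last exact: leq_trans uv.
  by apply: lerXn2r; rewrite ?nnegrE ?ler0n ?ler_nat.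
have X3 (k : nat) : ((3 * X)%N%:R ^+ k)^-1 = (3 ^+ k)^-1 * (X%:R ^+ k)^-1 :> R.
  by rewrite natrM exprMn invfM.
have c3 : separation_cst R b <= (3 ^+ b.+1)^-1.
  by rewrite /separation_cst lef_pV2 ?posrE ?exprn_gt0//; apply: ler_weXn2l => //; lra.
split.
- have := @inv_pow_diff_ge R b n n0 b0.
  rewrite /f -mulrBr /L mulrCA ler_pM2l// => h; apply: le_trans h.
  apply: (@le_trans _ _ (((3 * X)%N%:R ^+ b.+1)^-1)); last by apply: mon => //; lia.
  by rewrite X3; apply: ler_wpM2r => //; rewrite invr_ge0 exprn_ge0// ltW.
- have := @inv_pow_diff_le R b n n0.
  rewrite /f -mulrBr /L mulrCA ler_pM2l// => h; apply: le_trans h _.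
  rewrite -mulrA; apply: ler_wpM2l => //.
  have -> : 2 ^+ b.+1 / X%:R ^+ b.+1 = ((X%:R / 2) ^+ b.+1)^-1 :> R.
    by rewrite expr_div_n invf_div.
  rewrite lef_pV2 ?posrE ?exprn_gt0 ?divr_gt0 ?ltr0n//.
  apply: lerXn2r; rewrite ?nnegrE ?divr_ge0//.
  rewrite ler_pdivrMr// -natrM ler_nat; lia.
- have := @inv_pow_diff2_ge R b n n0 b0.
  have -> : f n - 2 * f n.+1 + f n.+2 =
    y * ((n%:R ^+ b)^-1 - 2 * (n.+1%:R ^+ b)^-1 + (n.+2%:R ^+ b)^-1) by rewrite /f; ring.
  have -> : separation_cst R b * L / X%:R = y * ((3 * X)%N%:R ^+ b.+2)^-1.
    have eX : (X%:R ^+ b.+2)^-1 = (X%:R ^+ b.+1)^-1 * X%:R^-1 :> R by rewrite exprSr invfM.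
    rewrite X3 /L /separation_cst eX.
    by move: ((3 : R) ^+ b.+2)^-1 ((X%:R : R) ^+ b.+1)^-1 (X%:R : R)^-1 => u v w; ring.
  rewrite ler_pM2l// => h; apply: le_trans h.
  by apply: mon => //; lia.
Qed.

(** 18 times the ratio of the upper step constant b 2^(b+1) to the lower one [separation_cst]. In
    the second difference test, 18 is 3 (number of windows) times 6 (cost of a window). *)
Definition exp_sum_cst (R : realType) (b : nat) : R :=
  18 * (b%:R * 2 ^+ b.+1) * 3 ^+ b.+2.

Lemma exp_sum_bound (R : realType) (b X m p h : nat) (y phi : R) :
  (0 < b)%N -> 0 < y -> (0 < m)%N -> (m <= p)%N -> (p <= X.+1)%N ->
  (X <= m.*2)%N -> (0 < h)%N ->
  `|\sum_(m <= n < p) cos (2 * pi * (h%:R * (y / n%:R ^+ b) + phi))| <=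
    exp_sum_cst R b * ((h%:R * (y / X%:R ^+ b.+1))^-1 +
                   Num.sqrt (h%:R * (y / X%:R ^+ b.+1) * X%:R)).
Proof.
move=> b0 y0 m0 mp pX Xm h0; set L := h%:R * (y / X%:R ^+ b.+1).
have hp : 0 < h%:R :> R by rewrite ltr0n.
have C1 : 4 <= b%:R * 2 ^+ b.+1 :> R.
  have b1 : 1 <= b%:R :> R by rewrite ler1n.
  have : 4 <= 2 ^+ b.+1 :> R.
    by have := @ler_weXn2l R 2 ltac:(lra) 2 b.+1 ltac:(by []); lra.
  nra.
have C3 : 9 <= 3 ^+ b.+2 :> R.
  by have := @ler_weXn2l R 3 ltac:(lra) 2 b.+2 ltac:(by []); lra.
move: mp; rewrite leq_eqVlt => /orP[/eqP mp|mp].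
  rewrite mp big_geq// normr0; apply: mulr_ge0.
    by rewrite /exp_sum_cst mulr_ge0 ?exprn_ge0// mulr_ge0// mulr_ge0 ?exprn_ge0.
  apply: addr_ge0; last exact: sqrtr_ge0.
  by rewrite invr_ge0 mulr_ge0// divr_ge0 ?exprn_ge0// ltW.
have X0 : (0 < X)%N by move: (leq_trans mp pX); rewrite ltnS; exact: leq_trans.
have Xp : 0 < X%:R :> R by rewrite ltr0n.
have L0 : 0 < L by rewrite !mulr_gt0// invr_gt0 exprn_gt0.
have i0 : 0 < L^-1 by rewrite invr_gt0.
set s := Num.sqrt (L * X%:R).
have sp : 0 < s by rewrite sqrtr_gt0 mulr_gt0.
have s2 : s ^+ 2 = L * X%:R by rewrite sqr_sqrtr// ltW// mulr_gt0.
set F := fun n : nat => h%:R * (y / n%:R ^+ b) + phi.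
set c := separation_cst R b; set C := b%:R * 2 ^+ b.+1 : R.
have Cp : 0 < C by rewrite /C; lra.
have c0 : 0 < c by rewrite invr_gt0 exprn_gt0.
have c1 : c <= 9^-1 by rewrite /c /separation_cst lef_pV2 ?posrE// exprn_gt0.
have eA : exp_sum_cst R b = 18 * C / c by rewrite /exp_sum_cst /c /separation_cst invrK.
have st n : (m <= n < p)%N -> [/\ c * L <= - (F n.+1 - F n), - (F n.+1 - F n) <= C * L
   & F n.+1 - F n + c * L / X%:R <= F n.+2 - F n.+1].
  move=> /(inv_pow_steps b0 y0 m0 pX Xm) /= [h1 h2 h3]; rewrite /F; split.
  - have := ler_wpM2l (ltW hp) h1; rewrite /L -/c; lra.
  - have := ler_wpM2l (ltW hp) h2; rewrite /L -/C; lra.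
  - have := ler_wpM2l (ltW hp) h3; rewrite /L -/c; lra.
have A0 : 0 < exp_sum_cst R b by rewrite eA divr_gt0// mulr_gt0.
have cLX : 0 < c * L / X%:R by rewrite divr_gt0// mulr_gt0.
have [small|big] := lerP (C * L) 2^-1.
  apply: (@le_trans _ _ (3 / (c * L))).
    apply: (@kuzmin_landau R F (c * L) (-1)) => [||n mn np]; first exact: mulr_gt0.
      move=> n /st[h1 h2 _]; rewrite mulrNz.
      have : c * L <= C * L by apply: ler_wpM2r; [exact: ltW|rewrite /C; lra].
      lra.
    have [_ _] := st n ltac:(by rewrite mn ltnW); lra.
  rewrite eA invfM mulrA; apply: ler_pM; rewrite ?(ltW i0)//.
  - by rewrite divr_ge0// ltW.
  - by apply: ler_wpM2r; [rewrite invr_ge0 ltW|rewrite /C; lra].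
  - by lra.
apply: (@le_trans _ _ (18 * C / c * s)); last first.
  by rewrite eA; apply: ler_wpM2l; [rewrite -eA ltW|lra].
(* The test is applied with th = s/X = sqrt(L/X), which balances th/lam against 1/th for lam of
   order L/X. If this th exceeds 1/2, then X < 2 s and counting terms is enough. *)
have [sX|Xs] := lerP (s / X%:R) 2^-1; last first.
  apply: le_trans (norm_sum_cos_le _ (ltnW mp)) _.
  apply: (@le_trans _ _ X%:R); first by rewrite ler_nat leq_subLR (leq_trans pX)// -add1n leq_add2r.
  move: Xs; rewrite ltr_pdivlMr// => Xs.
  apply: (@le_trans _ _ (2 * s)); first lra.
  apply: ler_wpM2r; first exact: ltW.
  by rewrite ler_pdivlMr// /C; lra.
have th0 : 0 < s / X%:R by rewrite divr_gt0.
have CL0 : 0 <= C * L by rewrite mulr_ge0// ltW.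
(* The increments lie in [-C L, -c L], hence in the K unit windows that cover [-K, 0). *)
pose K := (Num.truncn (C * L)).+1.
have /andP[K1 K2] := Num.Theory.truncn_itv CL0.
(* Uses C L > 1/2, the complement of the Kuzmin-Landau case, to absorb the rounding. *)
have K3 : K%:R <= 3 * (C * L) by rewrite /K -natr1; lra.
have := @second_diff_test R F (s / X%:R) (c * L / X%:R) (- K%:Z) K m p th0 sX cLX (ltnW mp).
move=> /(_ _ _)-H; apply: le_trans (H _ _) _ => {H}.
- by move=> n mn np; have [_ _] := st n ltac:(by rewrite mn ltnW).
- move=> n /st[h1 h2 _]; rewrite mulrNz addNr.
  have : 0 < c * L by rewrite mulr_gt0.
  have := K2; rewrite -/K => k2.
  by have -> : (K%:Z)%:~R = K%:R :> R by []; lra.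
have -> : s / X%:R / (c * L / X%:R) = s / (c * L) by field; rewrite !gt_eqF.
have sL : s / (c * L) = X%:R / s / c.
  have -> : X%:R = s ^+ 2 / L by rewrite s2 mulrAC divff ?gt_eqF// mul1r.
  by field; rewrite !gt_eqF.
rewrite sL invf_div mulrA.
apply: (@le_trans _ _ (3 * (C * L) * (6 * (X%:R / s / c)))).
  apply: ler_pM => //.
    have z2 : 0 <= X%:R / s by rewrite divr_ge0// ltW.
    have z1 : 0 <= X%:R / s / c by rewrite divr_ge0// ltW.
    by rewrite -[3 * _ / s]mulrA; move: (X%:R / s / c) (X%:R / s) z1 z2 => u v; lra.
  have Xs2 : 2 <= X%:R / s.
    by rewrite ler_pdivlMr//; move: sX; rewrite ler_pdivrMr//; lra.
  have : 9 * (X%:R / s) <= X%:R / s / c.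
    by rewrite mulrC; apply: ler_wpM2l; [lra|rewrite -[9]invrK lef_pV2 ?posrE].
  rewrite -[3 * X%:R / s]mulrA; move: (X%:R / s) Xs2 => q q2.
  move: (q / c) => r; lra.
have -> : 3 * (C * L) * (6 * (X%:R / s / c)) = 18 * C / c * (L * X%:R / s) by ring.
by rewrite -s2 expr2 mulfK// gt_eqF.
Qed.

Lemma exp_sum_cst_ge (R : realType) (b : nat) : (0 < b)%N -> 18 <= exp_sum_cst R b.
Proof.
move=> b0; have b1 : 1 <= b%:R :> R by rewrite ler1n.
have t1 : 1 <= 2 ^+ b.+1 :> R by rewrite exprn_ege1//; lra.
have t2 : 1 <= 3 ^+ b.+2 :> R by rewrite exprn_ege1//; lra.
have t3 : 1 <= b%:R * 2 ^+ b.+1 :> R by nra.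
rewrite /exp_sum_cst; move: (b%:R * _) (3 ^+ _) t2 t3 => u v v1 u1; nra.
Qed.

Lemma norm_saw_le (R : realType) (t : R) : `|saw t| <= 2^-1.
Proof.
have := Num.Theory.floor_itv t; rewrite intrD /saw ler_norml; lra.
Qed.

(* The number H ~ Z of harmonics balances the smoothing error X/H against the
   contribution of the second difference test. *)
Lemma block_bound (R : realType) (b X m p : nat) (y Z : R) :
  (0 < b)%N -> 0 < y -> (0 < m)%N -> (m <= p)%N -> (p <= X.+1)%N ->
  (X <= m.*2)%N -> (0 < X)%N -> 0 < Z -> Z ^+ 3 = X%:R ^+ b.+2 / y ->
  `|\sum_(m <= n < p) saw (y / n%:R ^+ b)| <=
    21 * exp_sum_cst R b * (X%:R / Z + X%:R ^+ b.+1 / y).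
Proof.
move=> b0 y0 m0 mp pX Xm X0 Z0 Z3.
have A18 := @exp_sum_cst_ge R b b0; set A := exp_sum_cst R b in A18 *.
have Xp : 0 < X%:R :> R by rewrite ltr0n.
have pmX : (p - m)%N%:R <= X%:R :> R.
  by rewrite ler_nat leq_subLR (leq_trans pX)// -add1n leq_add2r.
have [L eL] : exists L, L = y / X%:R ^+ b.+1 by eexists.
have L0 : 0 < L by rewrite eL divr_gt0// exprn_gt0.
have i0 : 0 < L^-1 by rewrite invr_gt0.
have -> : X%:R ^+ b.+1 / y = L^-1 by rewrite eL invf_div.
have XZ0 : 0 < X%:R / Z by rewrite divr_gt0.
(* For Z <= 1 the trivial bound X is already at most X/Z. Otherwise rounding Z up to H loses at most
   a factor 2. *)
have [Z1|Z1] := lerP Z 1.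
  apply: (@le_trans _ _ X%:R).
    apply: le_trans (ler_norm_sum _ _ _) _.
    apply: (@le_trans _ _ (\sum_(m <= n < p) 1)); last by rewrite sumr_const_nat.
    by apply: ler_sum => n _; have := norm_saw_le (y / n%:R ^+ b); lra.
  have : X%:R <= X%:R / Z by rewrite ler_pdivlMr// -{2}[X%:R]mulr1 ler_wpM2l// ltW.
  move: (X%:R / Z) XZ0 => q q0; nra.
pose H := (Num.truncn Z).+1.
have /andP[T1 T2] := Num.Theory.truncn_itv (ltW Z0).
have H0 : (0 < H)%N by [].
have H2 : H%:R <= 2 * Z by rewrite /H -natr1; lra.
have HZ : Z <= H%:R by exact: ltW.
have Hp : 0 < H%:R :> R by rewrite ltr0n.
pose U (h : nat) := A * ((h%:R * L)^-1 + Num.sqrt (h%:R * L * X%:R)).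
have [|M hM] := @saw_sum_bound R (fun n => y / n%:R ^+ b) U m p H mp H0.
  by move=> h phi h0; rewrite /U eL; exact: exp_sum_bound.
apply: le_trans hM _.
have e1 : \sum_(1 <= h < M.+1) fourier_weight R H h * U h <=
    A * (L^-1 * 3 + Num.sqrt (L * X%:R) * (4 * Num.sqrt H%:R)).
  apply: (@le_trans _ _ (A * (L^-1 * \sum_(1 <= h < M.+1) Num.sqrt h%:R / h%:R ^+ 2 +
     Num.sqrt (L * X%:R) * \sum_(1 <= h < M.+1) fourier_weight R H h * Num.sqrt h%:R))).
    rewrite !big_distrr -big_split big_distrr/=.
    apply: ler_sum_nat => h /andP[h0 _].
    have hp : 0 < h%:R :> R by rewrite ltr0n.
    rewrite /U mulrCA; apply: ler_wpM2l; first lra.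
    rewrite mulrDr; apply: lerD; last first.
      by rewrite -[h%:R * L * _]mulrA sqrtrM ?(ltW hp)// mulrA mulrC.
    rewrite invfM mulrA mulrC; apply: ler_wpM2l; first exact: ltW.
    apply: (@le_trans _ _ (h%:R^-1 * h%:R^-1)).
      by apply: ler_wpM2r; [rewrite invr_ge0 ltW|rewrite /fourier_weight ge_min lexx].
    rewrite -invfM -expr2 -{1}[_^-1]mul1r; apply: ler_wpM2r.
      by rewrite invr_ge0 sqr_ge0.
    have h1 : 1 <= h%:R :> R by rewrite ler1n.
    by have := ler_wsqrtr h1; rewrite sqrtr1.
  apply: ler_wpM2l; first lra.
  apply: lerD; apply: ler_wpM2l; rewrite ?sqrtr_ge0 ?(ltW i0)//.
    exact: sum_inv_sqrt3_le3.
  exact: sum_fourier_weight.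
have e2 : Num.sqrt (L * X%:R) * Num.sqrt H%:R <= 2 * (X%:R / Z).
  rewrite -sqrtrM; last by rewrite mulr_ge0 ?ltW.
  have -> : 2 * (X%:R / Z) = Num.sqrt ((2 * (X%:R / Z)) ^+ 2).
    by rewrite sqrtr_sqr ger0_norm// mulr_ge0// ltW.
  apply: ler_wsqrtr.
  (* This is where the cube relation acts: with H ~ Z, the quantity sqrt(L X H) becomes of the size
     X/Z of the smoothing error. *)
  have LX : L * X%:R = X%:R ^+ 2 / Z ^+ 3.
    by rewrite eL Z3 !exprSr; field; rewrite expf_neq0 !gt_eqF.
  rewrite LX; have -> : (2 * (X%:R / Z)) ^+ 2 = X%:R ^+ 2 / Z ^+ 3 * (4 * Z).
    by field; rewrite gt_eqF.
  apply: ler_wpM2l; last by lra.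
  by rewrite divr_ge0 ?exprn_ge0 ?ltW.
have e3 : 13 * (p - m)%N%:R / H%:R <= 13 * (X%:R / Z).
  rewrite -mulrA; apply: ler_wpM2l => //.
  apply: ler_pM => //.
  by rewrite lef_pV2 ?posrE.
have e4 : A * (Num.sqrt (L * X%:R) * Num.sqrt H%:R) <= A * (2 * (X%:R / Z)).
  by apply: ler_wpM2l => //; lra.
have e5 : 18 * (X%:R / Z) <= A * (X%:R / Z) by apply: ler_wpM2r => //; exact: ltW.
have e6 : 0 <= A * L^-1 by rewrite mulr_ge0// ?(ltW i0)//; lra.
have e7 : 0 <= A * (X%:R / Z) by rewrite mulr_ge0// ?(ltW XZ0)//; lra.
move: e1 e3 e4 e5 e6 e7; move: (X%:R / Z) (_ / H%:R) (L^-1) => q r li.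
move: (\sum_(_ <= _ < _) _) (Num.sqrt (L * _)) => S v; lra.
Qed.

(** * Dyadic summation of the weighted sawtooth sums *)

(** Summation by parts: the variation w p - w m and the final boundary term w p each multiply B. The
    weight is read at p, one past the last index, which later produces (X + 1)^b. *)
Lemma abel_weight (R : realType) (w s : nat -> R) (B : R) (m p : nat) :
  (m <= p)%N -> 0 <= w m -> (forall n, (m <= n < p)%N -> w n <= w n.+1) ->
  (forall q, (m <= q <= p)%N -> `|\sum_(m <= n < q) s n| <= B) ->
  `|\sum_(m <= n < p) w n * s n| <= 2 * w p * B.
Proof.
move=> mp wm wi hB.
have key q : (m <= q)%N -> (q <= p)%N -> w m <= w q /\
   `|\sum_(m <= n < q) w n * s n - w q * \sum_(m <= n < q) s n| <= (w q - w m) * B.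
  elim: q => [|q IH].
    rewrite leqn0 => /eqP -> _; split=> //.
    by rewrite !big_geq// mulr0 !subrr normr0 mul0r.
  rewrite leq_eqVlt => /orP[/eqP <- _|].
    by split=> //; rewrite !big_geq// mulr0 !subrr normr0 mul0r.
  rewrite ltnS => mq qp; have [h1 h2] := IH mq (ltnW qp).
  have h3 := wi q ltac:(by rewrite mq qp).
  split; first exact: le_trans h3.
  rewrite !big_nat_recr//=.
  set S := \sum_(_ <= _ < _) _ in h2 *; set T := \sum_(_ <= _ < _) _ in h2 *.
  have -> : S + w q * s q - w q.+1 * (T + s q) =
    (S - w q * T) - (w q.+1 - w q) * (T + s q) by ring.
  have h4 : `|T + s q| <= B.
    by have := hB q.+1 ltac:(by rewrite leqW// qp); rewrite big_nat_recr.
  apply: le_trans (ler_normB _ _) _.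
  rewrite normrM (ger0_norm (x := w q.+1 - w q)); last by rewrite subr_ge0.
  have : (w q.+1 - w q) * `|T + s q| <= (w q.+1 - w q) * B.
    by apply: ler_wpM2l => //; rewrite subr_ge0.
  lra.
have [h1 h2] := key p mp (leqnn p).
have h3 := hB p ltac:(by rewrite mp leqnn).
have B0 : 0 <= B by apply: le_trans h3.
have h4 : w p * `|\sum_(m <= n < p) s n| <= w p * B by apply: ler_wpM2l => //; lra.
have h5 : 0 <= w m * B by rewrite mulr_ge0.
rewrite -[X in `|X|](subrK (w p * \sum_(m <= n < p) s n)).
apply: le_trans (ler_normD _ _) _.
by rewrite [in X in _ + X]normrM (ger0_norm (x := w p)); [lra|lra].
Qed.

(** The target error at scale t. At t = x it is [error_bound] when b > 1, and [error_bound] without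
    its logarithm when b = 1. *)
Definition voronoi_err (R : realType) (b : nat) (y t : R) : R :=
  t `^ ((1 + 2 * b)%N%:R / 3) * y `^ (1 / 3) + t ^+ (1 + 2 * b) * y^-1.

Lemma voronoi_err_ge0 (R : realType) (b : nat) (y t : R) :
  0 <= y -> 0 <= t -> 0 <= voronoi_err b y t.
Proof.
move=> y0 t0; rewrite /voronoi_err addr_ge0 ?mulr_ge0 ?powR_ge0//.
  by rewrite exprn_ge0.
by rewrite invr_ge0.
Qed.

Lemma le_voronoi_err (R : realType) (b : nat) (y s t : R) :
  0 <= y -> 0 <= s -> s <= t -> voronoi_err b y s <= voronoi_err b y t.
Proof.
move=> y0 s0 st; have t0 := le_trans s0 st.
apply: lerD; apply: ler_wpM2r; rewrite ?powR_ge0 ?invr_ge0//.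
  by apply: ge0_ler_powR; rewrite ?nnegrE// divr_ge0.
by apply: lerXn2r; rewrite ?nnegrE.
Qed.

(** Both exponents of t are at least 1 once b >= 1. This gives the dyadic recursion its geometric
    decay. *)
Lemma voronoi_err_half (R : realType) (b : nat) (y t : R) :
  (0 < b)%N -> 0 <= y -> 0 <= t -> voronoi_err b y (t / 2) <= voronoi_err b y t / 2.
Proof.
move=> b0 y0 t0; rewrite /voronoi_err mulrDl.
have hh : 0 < (2^-1 : R) <= 1 by lra.
apply: lerD.
  rewrite mulrAC; apply: ler_wpM2r; first exact: powR_ge0.
  rewrite powRM//; apply: ler_wpM2l; first exact: powR_ge0.
  apply: ge1r_powR => //.
  by rewrite ler_pdivlMr// mul1r ler_nat; lia.
rewrite mulrAC; apply: ler_wpM2r; first by rewrite invr_ge0.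
rewrite exprMn; apply: ler_wpM2l; first exact: exprn_ge0.
by rewrite add1n exprS -[leRHS]mulr1; apply: ler_wpM2l => //; rewrite exprn_ile1//; lra.
Qed.

Lemma weighted_block (R : realType) (b X : nat) (y : R) :
  (0 < b)%N -> 0 < y -> (0 < X)%N ->
  `|\sum_(X./2.+1 <= n < X.+1) n%:R ^+ b * saw (y / n%:R ^+ b)| <=
    2 * 2 ^+ b * (21 * exp_sum_cst R b) * voronoi_err b y X%:R.
Proof.
move=> b0 y0 X0; have Xp : 0 < X%:R :> R by rewrite ltr0n.
have A18 := @exp_sum_cst_ge R b b0.
set W := y `^ (1 / 3); have W0 : 0 < W by rewrite powR_gt0.
pose P := X%:R `^ (b.+2%:R / 3) : R; have P0 : 0 < P by rewrite powR_gt0.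
pose Q := X%:R `^ ((1 + 2 * b)%N%:R / 3) : R.
have PQ : P * Q = X%:R ^+ b.+1.
  rewrite /P /Q -powRD ?(gt_eqF Xp) ?implybT// -powR_mulrn ?ltW//; congr (_ `^ _).
  have -> : b.+2%:R = b%:R + 2 :> R by rewrite -addn2 natrD.
  have -> : b.+1%:R = b%:R + 1 :> R by rewrite -addn1 natrD.
  by rewrite natrD natrM; field.
have cube (u r : R) : (u `^ (r / 3)) ^+ 3 = u `^ r.
  by rewrite -powR_mulrn ?powR_ge0// -powRrM; congr (_ `^ _); field.
(* The cube root of X^(b+2)/y required by [block_bound]. Since the exponents in P and Q add up to b
   + 1, X^b times X/Z is exactly Q W, the first term of [voronoi_err]. *)
pose Z := P / W.
have Z0 : 0 < Z by rewrite divr_gt0.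
have Z3 : Z ^+ 3 = X%:R ^+ b.+2 / y.
  by rewrite /Z expr_div_n !cube powRr1 ?ltW// powR_mulrn ?ltW.
have eqE : voronoi_err b y X%:R = X%:R ^+ b * (X%:R / Z + X%:R ^+ b.+1 / y).
  rewrite /voronoi_err -/W -/Q mulrDr; congr (_ + _).
    rewrite mulrA -exprSr -PQ /Z; field; rewrite !gt_eqF//.
  by rewrite mulrA -exprD; congr (_ ^+ _ / _); lia.
rewrite eqE; set E := X%:R / Z + _.
have E0 : 0 <= E.
  by rewrite addr_ge0// divr_ge0 ?exprn_ge0// ltW.
have h := @abel_weight R (fun n => n%:R ^+ b) (fun n => saw (y / n%:R ^+ b))
  (21 * exp_sum_cst R b * E) X./2.+1 X.+1.
apply: le_trans (h _ _ _ _) _.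
- by have := odd_double_half X; lia.
- by rewrite exprn_ge0.
- by move=> n _; apply: lerXn2r; rewrite ?nnegrE ?ler0n ?ler_nat.
- move=> q /andP[mq qX]; apply: block_bound => //.
  have := odd_double_half X; have := leq_b1 (odd X); lia.
have XX : X.+1%:R ^+ b <= 2 ^+ b * X%:R ^+ b :> R.
  rewrite -exprMn; apply: lerXn2r; rewrite ?nnegrE ?ler0n ?mulr_ge0//.
  by rewrite -natrM ler_nat; lia.
have c0 : 0 <= 2 * (21 * exp_sum_cst R b * E).
  by apply: mulr_ge0 => //; apply: mulr_ge0 => //; apply: mulr_ge0 => //; lra.
have := ler_wpM2r c0 XX.
move: (X.+1%:R ^+ b) (2 ^+ b) (X%:R ^+ b) (exp_sum_cst R b) E {E0 h c0} => u v w a e; lra.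
Qed.

(** Strong induction, removing the block (X/2, X]. By [voronoi_err_half] the lower half uses at most
    half of the target, so twice the constant of [weighted_block] closes the recursion. *)
Lemma voronoi_bound (R : realType) (b X : nat) (y : R) : (0 < b)%N -> 0 < y ->
  `|\sum_(1 <= n < X.+1) n%:R ^+ b * saw (y / n%:R ^+ b)| <=
    4 * 2 ^+ b * (21 * exp_sum_cst R b) * voronoi_err b y X%:R.
Proof.
move=> b0 y0; have A18 := @exp_sum_cst_ge R b b0.
have c0 : 0 <= 4 * 2 ^+ b * (21 * exp_sum_cst R b).
  by apply: mulr_ge0; [rewrite mulr_ge0 ?exprn_ge0|lra].
elim/ltn_ind: X => -[_|X IH].
  rewrite big_geq// normr0; apply: mulr_ge0 => //.
  by apply: voronoi_err_ge0 => //; exact: ltW.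
rewrite (big_cat_nat (n := X.+1./2.+1))//=; last first.
  by have := odd_double_half X.+1; lia.
apply: le_trans (ler_normD _ _) _.
have h1 := IH X.+1./2 ltac:(by have := odd_double_half X.+1; lia).
have h2 := @weighted_block R b X.+1 y b0 y0 isT.
have h3 : voronoi_err b y X.+1./2%:R <= voronoi_err b y X.+1%:R / 2.
  apply: le_trans (voronoi_err_half b0 (ltW y0) (ler0n _ _)).
  apply: le_voronoi_err => //; first exact: ltW.
  by rewrite ler_pdivlMr// -natrM ler_nat; have := odd_double_half X.+1; lia.
have := ler_wpM2l c0 h3; move: h1 h2 => /=; lra.
Qed.

(** * Moebius function and Cohen sums *)

Definition mobius (n : nat) : int :=
  if all (fun p => logn p n == 1%N) (primes n) then (-1) ^+ size (primes n) else 0.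

Lemma norm_mobius_le1 (n : nat) : `|mobius n| <= 1.
Proof. by rewrite /mobius; case: ifP => // _; rewrite normrX normrN1 expr1n. Qed.

Lemma mobius_prime_mul (p d : nat) : prime p -> (0 < d)%N ->
  mobius (p * d) = if (p %| d)%N then 0 else - mobius d.
Proof.
move=> pp d0; have p0 := prime_gt0 pp.
have pmem : p \in primes (p * d) by rewrite mem_primes pp muln_gt0 p0 d0 dvdn_mulr.
case: ifP => pd.
  rewrite /mobius; case: ifP => // /allP /(_ p pmem).
  by rewrite lognM// logn_prime// eqxx eqn_leq add1n ltnS leqNgt logn_gt0 mem_primes pp d0 pd.
have pn : p \notin primes d by rewrite mem_primes pd !andbF.
have pr : perm_eq (primes (p * d)) (p :: primes d).
  apply: uniq_perm; rewrite /= ?primes_uniq ?pn// => q.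
  by rewrite primesM// primes_prime// !inE.
rewrite /mobius (perm_all _ pr) (perm_size pr) /= lognM// logn_prime// eqxx.
have -> : logn p d = 0%N by rewrite lognE pp d0 pd.
rewrite addn0 eqxx/=.
have -> : all (fun q => logn q (p * d) == 1%N) (primes d) =
          all (fun q => logn q d == 1%N) (primes d).
  apply: eq_in_all => q qd; rewrite lognM// logn_prime//.
  have -> : (q == p) = false by apply: contraNF pn => /eqP <-.
  by [].
by case: ifP => _; rewrite ?oppr0// exprS mulN1r.
Qed.

Lemma dvd_reindex (V : nmodType) (F : nat -> V) (a N : nat) : (0 < a)%N ->
  \sum_(1 <= q < N.+1 | (a %| q)%N) F q = \sum_(1 <= d < (N %/ a).+1) F (a * d)%N.
Proof.
move=> a0; rewrite -big_filter -(big_map (muln a) predT F); apply: perm_big.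
apply: uniq_perm; first by rewrite filter_uniq// iota_uniq.
  by rewrite map_inj_uniq ?iota_uniq// => i j /eqP; rewrite eqn_pmul2l// => /eqP.
move=> q; rewrite mem_filter mem_index_iota; apply/andP/mapP => [[aq /andP[q0 qN]]|[d]].
  exists (q %/ a)%N; last by rewrite mulnC divnK.
  by rewrite mem_index_iota divn_gt0// dvdn_leq//= ltnS leq_div2r.
rewrite mem_index_iota ltnS => /andP[d0 dN] ->; rewrite dvdn_mulr// muln_gt0 a0 d0 ltnS.
by split=> //; apply: leq_trans (leq_trunc_div N a); rewrite mulnC leq_mul2r dN orbT.
Qed.

Lemma sum_divisors (V : nmodType) (F : nat -> V) (n N : nat) : (0 < n <= N)%N ->
  \sum_(1 <= d < N.+1 | (d %| n)%N) F d = \sum_(d <- divisors n) F d.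
Proof.
move=> /andP[n0 nN]; rewrite -big_filter; apply: perm_big.
apply: uniq_perm; rewrite ?divisors_uniq ?filter_uniq ?iota_uniq// => d.
rewrite mem_filter mem_index_iota -dvdn_divisors//.
apply/andP/idP => [[]//|dn]; split=> //.
by rewrite (dvdn_gt0 n0 dn) ltnS (leq_trans (dvdn_leq n0 dn)).
Qed.

(** For n > 1 and p its least prime factor, the divisors d prime to p cancel against p d, and
    multiples of p^2 contribute 0. *)
Lemma sum_mobius (n : nat) : (0 < n)%N ->
  \sum_(d <- divisors n) mobius d = (n == 1%N)%:R.
Proof.
move=> n0; have [->|n1] := eqVneq n 1%N.
  by rewrite (_ : divisors 1 = [:: 1%N])// big_seq1.
have n2 : (1 < n)%N by rewrite ltn_neqAle eq_sym n1.
have pp := pdiv_prime n2; set p := pdiv n in pp; have p0 := prime_gt0 pp.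
have pn : (p %| n)%N by exact: pdiv_dvd.
rewrite -(@sum_divisors _ _ n n) ?n0 ?leqnn//.
rewrite (bigID (fun d => (p %| d)%N))/=.
have -> : \sum_(1 <= d < n.+1 | (d %| n)%N && (p %| d)%N) mobius d =
   \sum_(1 <= d < n.+1 | (p %| d)%N) (if (d %| n)%N then mobius d else 0).
  by rewrite big_mkcondl; apply: eq_bigr.
rewrite dvd_reindex//.
(* A divisor d of n prime to p satisfies p d | n, hence d <= n/p, so both sums run over the same
   range and cancel termwise. *)
have -> : \sum_(1 <= d < n.+1 | (d %| n)%N && ~~ (p %| d)%N) mobius d =
  \sum_(1 <= d < (n %/ p).+1) (if (d %| n)%N && ~~ (p %| d)%N then mobius d else 0).
  rewrite [LHS]big_mkcond/= (big_cat_nat (n := (n %/ p).+1))//=; last first.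
    by rewrite ltnS leq_div.
  rewrite [X in _ + X]big_nat_cond [X in _ + X]big1 ?addr0// => d /andP[/andP[dp dn] _].
  case: ifP => // /andP[dvn npd].
  have : (p * d %| n)%N by rewrite Gauss_dvd ?pn ?dvn// prime_coprime.
  move=> /(dvdn_leq n0); rewrite mulnC -leq_divRL// leqNgt.
  by rewrite dp.
rewrite -big_split/= big_nat big1// => d /andP[d0 _].
rewrite mobius_prime_mul//; case: (boolP (p %| d)%N) => pd.
  by rewrite andbF addr0; case: ifP.
rewrite andbT Gauss_dvd ?prime_coprime// pn/=.
by case: ifP => _; rewrite ?addr0// addNr.
Qed.

Lemma dirichlet_swap (V : nmodType) (F : nat -> nat -> V) (N : nat) :
  \sum_(1 <= q < N.+1) \sum_(g <- divisors q) F g (q %/ g)%N =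
  \sum_(1 <= g < N.+1) \sum_(1 <= d < (N %/ g).+1) F g d.
Proof.
transitivity (\sum_(1 <= q < N.+1) \sum_(1 <= g < N.+1)
    if (g %| q)%N then F g (q %/ g)%N else 0).
  apply: eq_big_nat => q /andP[q0 qN].
  by rewrite -big_mkcond/= sum_divisors// q0.
rewrite exchange_big/=; apply: eq_big_nat => g /andP[g0 _].
rewrite -big_mkcond/= dvd_reindex//.
by apply: eq_bigr => d _; rewrite mulKn.
Qed.

(** Moebius inversion in summatory form: grouping by q = k d leaves only q = 1. The choice F = 1
    gives the main term y exactly, and F(n) = n^(-b-1) gives the inverse zeta value. *)
Lemma sum_mobius_div (R : pzRingType) (F : nat -> R) (N : nat) : (0 < N)%N ->
  \sum_(1 <= k < N.+1) (mobius k)%:~R * \sum_(1 <= d < (N %/ k).+1) F (k * d)%N = F 1%N.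
Proof.
move=> N0.
under eq_bigr do rewrite mulr_sumr.
rewrite -(dirichlet_swap (fun k d => (mobius k)%:~R * F (k * d)%N)).
transitivity (\sum_(1 <= q < N.+1) (q == 1%N)%:R%:~R * F q).
  apply: eq_big_nat => q /andP[q0 _].
  rewrite -sum_mobius// rmorph_sum/= mulr_suml; apply: eq_big_seq => g.
  by rewrite -dvdn_divisors// => gq; rewrite mulnC divnK.
rewrite big_ltn// big_nat big1 ?addr0 ?mul1r// => q /andP[q1 _].
by rewrite gtn_eqF// mul0r.
Qed.

(** Write a = d u and b = d v with u, v coprime; after removing d^k the coprime powers u^k and v^k
    divide together. Closure under lcm is what makes a largest admissible g exist. *)
Lemma lcm_exp_dvd (a b k h : nat) : (0 < a)%N -> (0 < b)%N ->
  (a ^ k %| h)%N -> (b ^ k %| h)%N -> (lcmn a b ^ k %| h)%N.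
Proof.
move=> a0 b0; set d := gcdn a b.
have d0 : (0 < d)%N by rewrite gcdn_gt0 a0.
have da : (d %| a)%N := dvdn_gcdl a b; have db : (d %| b)%N := dvdn_gcdr a b.
have [u eu] : exists u, a = (d * u)%N by exists (a %/ d)%N; rewrite mulnC divnK.
have [v ev] : exists v, b = (d * v)%N by exists (b %/ d)%N; rewrite mulnC divnK.
have cuv : coprime u v.
  have : (d * gcdn u v = d * 1)%N by rewrite muln_gcdr -eu -ev muln1.
  by move=> /eqP; rewrite eqn_pmul2l.
have -> : lcmn a b = (d * (u * v))%N.
  apply/eqP; rewrite -(eqn_pmul2r d0) -{1}/d muln_lcm_gcd eu ev; apply/eqP; lia.
rewrite eu ev !expnMn => /dvdnP[w ->].
have dk0 : (0 < d ^ k)%N by rewrite expn_gt0 d0.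
rewrite (mulnCA w) !dvdn_pmul2l//.
move=> hv; rewrite Gauss_dvd ?coprimeXl ?coprimeXr//.
by rewrite hv dvdn_mull.
Qed.

(* G is the largest g with g | q and g^beta | h, the analogue of gcd(h, q). *)
Lemma beta_gcd_exists (beta h q : nat) : (0 < beta)%N -> (0 < q)%N ->
  exists2 G, (0 < G)%N & forall g, ((g %| q) && (g ^ beta %| h) = (g %| G))%N.
Proof.
move=> b0 q0.
pose K g := ((g %| q) && (g ^ beta %| h))%N.
pose G := \big[lcmn/1%N]_(g <- divisors q | (g ^ beta %| h)%N) g.
have KG : K G.
  rewrite /G big_seq_cond; apply: (big_ind K).
  - by rewrite /K dvd1n exp1n dvd1n.
  - move=> a b /andP[aq ah] /andP[bq bh]; rewrite /K dvdn_lcm aq bq/=.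
    by apply: lcm_exp_dvd => //; [exact: (dvdn_gt0 q0 aq)|exact: (dvdn_gt0 q0 bq)].
  - by move=> g /andP[]; rewrite -dvdn_divisors// /K => -> ->.
have /andP[Gq Gh] := KG.
exists G; first exact: (dvdn_gt0 q0 Gq).
move=> g; apply/andP/idP => [[gq gh]|gG].
  rewrite /G -big_filter (bigD1_seq g)/= ?filter_uniq ?divisors_uniq ?dvdn_lcml//.
  by rewrite mem_filter -dvdn_divisors ?gh.
split; first exact: dvdn_trans Gq.
by apply: dvdn_trans Gh; rewrite dvdn_pexp2r.
Qed.

(** The admissible g are exactly the divisors of the generalized gcd G, so the sum is the indicator
    of G = 1. *)
Lemma beta_coprime_mobius (beta h q : nat) : (0 < beta)%N -> (0 < q)%N ->
  \sum_(g <- divisors q | (g ^ beta %| h)%N) mobius g =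
  (`[< beta_coprime beta h (q ^ beta) >])%:R.
Proof.
move=> b0 q0; have [G G0 hG] := beta_gcd_exists h b0 q0.
rewrite -big_filter (perm_big (divisors G)); last first.
  apply: uniq_perm; rewrite ?filter_uniq ?divisors_uniq// => g.
  by rewrite mem_filter -!dvdn_divisors// andbC hG.
rewrite sum_mobius//; congr (_%:R); congr nat_of_bool.
apply/eqP/asboolP => [G1 d dh dq|bc].
  have : (d %| G)%N by rewrite -hG dh -(dvdn_pexp2r _ _ b0) dq.
  by rewrite G1 dvdn1 => /eqP ->; rewrite exp1n.
have /andP[Gq Gh] : ((G %| q) && (G ^ beta %| h))%N by rewrite hG.
have /eqP := bc G Gh ltac:(by rewrite dvdn_pexp2r).
by rewrite -[X in _ == X](exp1n beta) eqn_exp2r// => /eqP.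
Qed.

(** * Roots of unity and the reduction of C_1 to floor sums *)

Local Open Scope complex_scope.

Lemma dvd_reindex0 (V : nmodType) (F : nat -> V) (a b : nat) : (0 < a)%N ->
  \sum_(0 <= h < a * b | (a %| h)%N) F h = \sum_(0 <= e < b) F (a * e)%N.
Proof.
move=> a0; rewrite -big_filter -(big_map (muln a) predT F); apply: perm_big.
apply: uniq_perm; first by rewrite filter_uniq// iota_uniq.
  by rewrite map_inj_uniq ?iota_uniq// => i j /eqP; rewrite eqn_pmul2l// => /eqP.
move=> q; rewrite mem_filter mem_index_iota; apply/andP/mapP => [[aq qN]|[e]].
  exists (q %/ a)%N; last by rewrite mulnC divnK.
  by rewrite mem_index_iota/= ltn_divLR// mulnC.
by rewrite mem_index_iota => /= eb ->; rewrite dvdn_mulr// ltn_pmul2l.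
Qed.

Lemma cexp_imag (R : realType) (t : R) : cexp (t *i) = cos t +i* sin t.
Proof. by rewrite /cexp /= expR0 mul1r. Qed.

Lemma cexp_imag_pow (R : realType) (t : R) (h : nat) :
  (cos t +i* sin t) ^+ h = cos (h%:R * t) +i* sin (h%:R * t).
Proof.
elim: h => [|h IH]; first by rewrite expr0 mul0r cos0 sin0.
rewrite exprSr IH -(natr1 h) mulrDl mul1r cosD sinD.
by apply/eqP; rewrite eq_complex/=; apply/andP; split; apply/eqP; ring.
Qed.

Lemma root_sum (R : realType) (n Q : nat) : (0 < Q)%N ->
  \sum_(0 <= h < Q) cexp ((2 * pi * n%:R * h%:R / Q%:R) *i) =
  (if (Q %| n)%N then Q%:R else 0 : R[i]).
Proof.
move=> Q0; have Qp : 0 < Q%:R :> R by rewrite ltr0n.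
set th : R := 2 * pi * (n%:R / Q%:R).
set z : R[i] := cos th +i* sin th.
have -> : \sum_(0 <= h < Q) cexp ((2 * pi * n%:R * h%:R / Q%:R) *i) =
    \sum_(0 <= h < Q) z ^+ h.
  apply: eq_bigr => h _; rewrite cexp_imag cexp_imag_pow /th.
  by have -> : 2 * pi * n%:R * h%:R / Q%:R = h%:R * (2 * pi * (n%:R / Q%:R)) :> R by ring.
have cos1z : cos th = 1 -> z = 1.
  by move=> c1; rewrite /z (@cos1sin0 R th) c1// normr1.
have cosint k : cos (2 * pi * k%:R) = 1 :> R.
  by rewrite -[k%:R]add0r -[k%:R]/((k%:Z)%:~R) cos_shift mulr0 cos0.
case: ifP => Qn.
  have -> : z = 1.
    by apply: cos1z; rewrite /th -[n in LHS](divnK Qn) natrM mulfK ?gt_eqF.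
  under eq_bigr do rewrite expr1n.
  by rewrite sumr_const_nat subn0.
have z1 : z != 1.
  apply/eqP => /(congr1 (@complex.Re R)) /= c1.
  have := divn_eq n Q; set k := (n %/ Q)%N; set r := (n %% Q)%N => nk.
  have r0 : 0 < r%:R :> R by rewrite ltr0n lt0n; move/negbT: Qn.
  have rQ : r%:R < Q%:R :> R by rewrite ltr_nat ltn_mod.
  have e : n%:R / Q%:R = r%:R / Q%:R + k%:Z%:~R :> R.
    by rewrite {1}nk natrD natrM mulrDl mulfK ?gt_eqF// addrC.
  move: c1; rewrite /th e cos_shift.
  have -> : 2 * pi * (r%:R / Q%:R) = (pi * (r%:R / Q%:R)) *+ 2 :> R.
    by rewrite -mulr_natr; ring.
  have s0 : 0 < sin (pi * (r%:R / Q%:R)) :> R.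
    apply: sin_gt0_pi; rewrite mulr_gt0 ?pi_gt0 ?divr_gt0//=.
    by rewrite gtr_pMr ?pi_gt0// ltr_pdivrMr// mul1r.
  rewrite cos_mulr2n cos2sin2; move: (sin _) s0 => s s0; rewrite mulr2n => h.
  have : s ^+ 2 = 0 by lra.
  by move/eqP; rewrite sqrf_eq0 gt_eqF.
have zQ : z ^+ Q = 1.
  rewrite cexp_imag_pow /th.
  have -> : Q%:R * (2 * pi * (n%:R / Q%:R)) = 2 * pi * n%:R :> R.
    by rewrite mulrCA; congr (_ * _); rewrite mulrCA divff ?mulr1 ?gt_eqF.
  by rewrite (@cos1sin0 R (2 * pi * n%:R)) cosint// normr1.
have := subrX1 z Q; rewrite zQ subrr => /esym/eqP.
by rewrite mulf_eq0 subr_eq0 (negPf z1)/= big_mkord => /eqP.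
Qed.

(** After Moebius detection of the coprimality condition, h = g^beta e turns each inner sum into a
    complete sum over roots of unity of order (q/g)^beta, where orthogonality applies. *)
Lemma cohen_sum_mobius (R : realType) (beta q n : nat) : (0 < beta)%N -> (0 < q)%N ->
  cohen_sum R beta q n = \sum_(g <- divisors q) (mobius g)%:~R *
    (if ((q %/ g) ^ beta %| n)%N then ((q %/ g) ^ beta)%N%:R else 0).
Proof.
move=> b0 q0; rewrite /cohen_sum big_mkcond/=.
pose e (h : nat) : R[i] := cexp ((2 * pi * n%:R * h%:R / (q ^ beta)%:R) *i).
transitivity (\sum_(0 <= h < q ^ beta) \sum_(g <- divisors q)
    if (g ^ beta %| h)%N then (mobius g)%:~R * e h else 0).
  apply: eq_bigr => h _; rewrite -big_mkcond/= -mulr_suml -rmorph_sum/=.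
  rewrite beta_coprime_mobius//; case: (asboolP _) => _; first by rewrite mul1r.
  by rewrite mul0r.
rewrite exchange_big/=; apply: eq_big_seq => g; rewrite -dvdn_divisors// => gq.
rewrite -big_mkcond/= -mulr_sumr; congr (_ * _).
have g0 : (0 < g)%N := dvdn_gt0 q0 gq.
have e1 : (q ^ beta = g ^ beta * (q %/ g) ^ beta)%N by rewrite -expnMn mulnC divnK.
have gb0 : (0 < g ^ beta)%N by rewrite expn_gt0 g0.
rewrite e1 dvd_reindex0// -root_sum; last by rewrite expn_gt0 divn_gt0// dvdn_leq.
apply: eq_bigr => h _; rewrite /e e1; congr (cexp (_ *i)).
have u0 : (g ^ beta)%N%:R != 0 :> R by rewrite pnatr_eq0 -lt0n.
have v0 : ((q %/ g) ^ beta)%N%:R != 0 :> R.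
  by rewrite pnatr_eq0 -lt0n expn_gt0 divn_gt0// dvdn_leq.
rewrite !natrM; move: (2 * pi * n%:R) => w.
move: ((g ^ beta)%N%:R : R) (((q %/ g) ^ beta)%N%:R : R) u0 v0 => u v u0 v0.
by field; rewrite ?u0 ?v0.
Qed.

Lemma count_multiples (D Y : nat) : (0 < D)%N ->
  (\sum_(1 <= n < Y.+1 | (D %| n)%N) 1 = Y %/ D)%N.
Proof.
move=> D0; rewrite (@dvd_reindex nat (fun=> 1%N)) //.
by rewrite sum_nat_const_nat muln1 subn1.
Qed.

(** Summing over n first counts the multiples of d^beta up to y. The result is visibly real, so the
    remaining estimates take place in R. *)
Lemma C1_mobius (R : realType) (beta : nat) (x y : R) : (0 < beta)%N ->
  C1 beta x y = (\sum_(1 <= k < (Num.truncn x).+1) (mobius k)%:~R *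
    \sum_(1 <= d < (Num.truncn x %/ k).+1)
      (d%:R ^+ beta * (Num.truncn y %/ d ^ beta)%N%:R))%:C.
Proof.
move=> b0; rewrite /C1; set N := Num.truncn x; set Y := Num.truncn y.
rewrite exchange_big/=.
transitivity (\sum_(1 <= q < N.+1) \sum_(g <- divisors q) (mobius g)%:~R *
   (((q %/ g) ^ beta)%N%:R * (Y %/ (q %/ g) ^ beta)%N%:R) : R[i]).
  apply: eq_big_nat => q /andP[q0 _].
  under eq_bigr do rewrite cohen_sum_mobius//.
  rewrite exchange_big/=; apply: eq_big_seq => g; rewrite -dvdn_divisors// => gq.
  rewrite -mulr_sumr; congr (_ * _).
  have g0 : (0 < g)%N := dvdn_gt0 q0 gq.
  set D := ((q %/ g) ^ beta)%N.
  have D0 : (0 < D)%N by rewrite expn_gt0 divn_gt0// dvdn_leq.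
  rewrite -count_multiples// -big_mkcond/= natr_sum mulr_sumr.
  by apply: eq_bigr => i _; rewrite mulr1.
rewrite (dirichlet_swap (fun g d => (mobius g)%:~R *
   ((d ^ beta)%N%:R * (Y %/ d ^ beta)%N%:R) : R[i])).
rewrite rmorph_sum/=; apply: eq_bigr => k _.
rewrite rmorphM/= rmorph_int rmorph_sum/= mulr_sumr.
by apply: eq_bigr => d _; rewrite rmorphM/= !rmorphXn/= !rmorph_nat.
Qed.

(** * Power sums, the zeta value and the final estimate *)

Lemma pow_succ_diff (R : realType) (b : nat) (m : R) : 0 <= m ->
  b.+1%:R * m ^+ b <= (m + 1) ^+ b.+1 - m ^+ b.+1 <= b.+1%:R * (m + 1) ^+ b.
Proof.
move=> m0; elim: b => [|b IH]; first by rewrite !expr0 !expr1; lra.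
have mb : 0 <= m ^+ b.+1 by rewrite exprn_ge0.
have mz : m ^+ b.+1 <= (m + 1) ^+ b.+1 by apply: lerXn2r; rewrite ?nnegrE; lra.
have -> : (m + 1) ^+ b.+2 - m ^+ b.+2 =
   (m + 1) * ((m + 1) ^+ b.+1 - m ^+ b.+1) + m ^+ b.+1 by rewrite !exprS; ring.
have e1 : m ^+ b.+1 = m * m ^+ b by rewrite exprS.
have e2 : (m + 1) ^+ b.+1 = (m + 1) * (m + 1) ^+ b by rewrite exprS.
have e3 : b.+2%:R = b.+1%:R + 1 :> R by rewrite -addn1 natrD.
case/andP: IH; move: ((m + 1) ^+ b.+1 - m ^+ b.+1) => D h1 h2.
apply/andP; split.
  have h := ler_pM m0 (mulr_ge0 (ler0n R b.+1) (exprn_ge0 b m0)) (_ : m <= m + 1) h1.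
  by have := h ltac:(lra); rewrite e3 e1; move: (m ^+ b) => q; lra.
have h := ler_wpM2l (_ : 0 <= m + 1) h2.
have := h ltac:(lra); rewrite e3; move: mz; rewrite e2.
by move: (m ^+ b.+1) ((m + 1) ^+ b) => p q; lra.
Qed.

(** Both t^(b+1) and b + 1 times the power sum lie between n^(b+1) and (n+1)^(b+1), whose difference
    is at most (b+1)(n+1)^b; finally n + 1 <= 2 t. *)
Lemma sum_pow_approx (R : realType) (b n : nat) (t : R) : (0 < n)%N ->
  n%:R <= t < n.+1%:R ->
  `|\sum_(1 <= d < n.+1) d%:R ^+ b - t ^+ b.+1 / b.+1%:R| <= 2 ^+ b * t ^+ b.
Proof.
move=> n0 /andP[nt tn].
have bp : 0 < b.+1%:R :> R by rewrite ltr0n.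
have np : 1 <= n%:R :> R by rewrite ler1n.
have nn : n.+1%:R = n%:R + 1 :> R by rewrite -natr1.
have lo : n%:R ^+ b.+1 <= b.+1%:R * \sum_(1 <= d < n.+1) d%:R ^+ b :> R.
  elim: n {n0 nt tn np nn} => [|n IH]; first by rewrite big_geq// mulr0 expr0n.
  rewrite big_nat_recr//= mulrDr -(natr1 n).
  have := @pow_succ_diff R b n%:R (ler0n _ _); lra.
have hi : b.+1%:R * \sum_(1 <= d < n.+1) d%:R ^+ b <= n.+1%:R ^+ b.+1 :> R.
  elim: n {n0 nt tn np nn lo} => [|n IH]; first by rewrite big_geq// mulr0 exprn_ge0.
  rewrite big_nat_recr//= mulrDr.
  have := @pow_succ_diff R b n.+1%:R (ler0n _ _); rewrite natr1; lra.
have t0 : 0 <= t by lra.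
have b1 : n%:R ^+ b.+1 <= t ^+ b.+1 by apply: lerXn2r; rewrite ?nnegrE; lra.
have b2 : t ^+ b.+1 <= n.+1%:R ^+ b.+1.
  by apply: lerXn2r; rewrite ?nnegrE//; exact: ltW.
have b3 : (n.+1%:R) ^+ b <= 2 ^+ b * t ^+ b.
  by rewrite -exprMn; apply: lerXn2r; rewrite ?nnegrE//; lra.
have /andP[_ b4] := @pow_succ_diff R b n%:R (ler0n _ _).
rewrite natr1 in b4.
have b5 : b.+1%:R * n.+1%:R ^+ b <= b.+1%:R * (2 ^+ b * t ^+ b) by apply: ler_wpM2l b3; exact: ltW.
set S := \sum_(_ <= _ < _) _ in lo hi *.
have -> : S - t ^+ b.+1 / b.+1%:R = (b.+1%:R * S - t ^+ b.+1) / b.+1%:R.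
  by rewrite mulrBl mulrAC divff ?gt_eqF// mul1r.
rewrite normrM normfV (ger0_norm (ltW bp)) ler_pdivrMr// ler_norml; lra.
Qed.

Definition zeta_partial (R : realType) (b n : nat) : R := \sum_(1 <= m < n.+1) (m%:R ^+ b.+1)^-1.

(** Each term m^(-b-1) is at most (m-1)^-b - m^-b by [inv_pow_diff_ge], so the tail telescopes. *)
Lemma zeta_partial_tail (R : realType) (b n N : nat) : (0 < b)%N -> (0 < n <= N)%N ->
  zeta_partial R b n <= zeta_partial R b N <= zeta_partial R b n + (n%:R ^+ b)^-1 - (N%:R ^+ b)^-1.
Proof.
move=> b0 /andP[n0]; elim: N => [|N IH]; first by rewrite leqn0 => /eqP e; rewrite e in n0.
rewrite leq_eqVlt => /orP[/eqP <-|]; first by lra.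
rewrite ltnS => nN; have := IH nN.
have := @inv_pow_diff_ge R b N (leq_trans n0 nN) b0.
have : 0 <= (N.+1%:R ^+ b.+1)^-1 :> R by rewrite invr_ge0 exprn_ge0.
have -> : zeta_partial R b N.+1 = zeta_partial R b N + (N.+1%:R ^+ b.+1)^-1.
  by rewrite /zeta_partial big_nat_recr.
by move: (N.+1%:R ^+ b.+1)^-1 (N.+1%:R ^+ b)^-1 (N%:R ^+ b)^-1 (n%:R ^+ b)^-1 => p q r s; lra.
Qed.

Lemma zeta_partial_approx (R : realType) (b n : nat) : (0 < b)%N -> (0 < n)%N ->
  zeta_partial R b n <= zeta ((1 + b)%N%:R : R) <= zeta_partial R b n + (n%:R ^+ b)^-1.
Proof.
move=> b0 n0; rewrite /zeta.
have -> : series (fun k : nat => (k.+1%:R `^ ((1 + b)%N%:R : R))^-1) = zeta_partial R b.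
  apply/funext => k; rewrite /series/= /zeta_partial big_add1/=.
  by apply: eq_bigr => i _; rewrite powR_mulrn.
have mon : nondecreasing_seq (zeta_partial R b).
  move=> i j ij; rewrite /zeta_partial (big_cat_nat (n := i.+1) (p := j.+1))//=.
  by rewrite lerDl sumr_ge0// => k _; rewrite invr_ge0 exprn_ge0.
have ub N : zeta_partial R b N <= zeta_partial R b n + (n%:R ^+ b)^-1.
  have [nN|Nn] := leqP n N.
    have := @zeta_partial_tail R b n N b0 ltac:(by rewrite n0).
    have : 0 <= (N%:R ^+ b)^-1 :> R by rewrite invr_ge0 exprn_ge0.
    move: (_ ^+ _)^-1 (_ ^+ _)^-1 => u v; lra.
  apply: le_trans (mon _ _ (ltnW Nn)) _.
  by rewrite lerDl invr_ge0 exprn_ge0.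
have cv : cvgn (zeta_partial R b).
  apply: nondecreasing_is_cvgn => //.
  by exists (zeta_partial R b n + (n%:R ^+ b)^-1) => _ [N _ <-]; exact: ub.
apply/andP; split; first exact: nondecreasing_cvgn_le.
by apply: limr_le => //; near=> N; exact: ub.
Unshelve. all: by end_near.
Qed.

Lemma harmonic_le (R : realType) (N : nat) : (0 < N)%N ->
  \sum_(1 <= k < N.+1) (k%:R)^-1 <= 1 + ln N%:R :> R.
Proof.
case: N => // N _; elim: N => [|N IH].
  by rewrite big_nat1 invr1 ln1 addr0.
rewrite big_nat_recr//=; set z : R := N.+2%:R; set m : R := N.+1%:R in IH *.
have m0 : 0 < m by rewrite ltr0n.
have zm : z = m + 1 by rewrite /z -natr1.
have z0 : 0 < z by lra.
suff : z^-1 <= ln z - ln m.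
  by move=> h; apply: le_trans (lerD IH h) _; lra.
have := @le_ln1Dx R (- z^-1).
have -> : 1 + - z^-1 = m / z.
  have -> : m = z - 1 by rewrite zm addrK.
  by rewrite mulrBl divff ?mul1r// gt_eqF.
rewrite ln_div ?posrE//.
have z1 : z^-1 < 1 by rewrite invf_lt1//; lra.
by move: z^-1 z1 => u u1 h; have := h ltac:(lra); lra.
Qed.

(** Nested floors collapse: dividing the integer part of y by D with integer division gives the
    floor of y/D. *)
Lemma natr_divn_saw (R : realType) (y : R) (D : nat) : 0 <= y -> (0 < D)%N ->
  (Num.truncn y %/ D)%N%:R = y / D%:R - 2^-1 - saw (y / D%:R).
Proof.
move=> y0 D0; have Dp : 0 < D%:R :> R by rewrite ltr0n.
have /andP[h1 h2] := Num.Theory.truncn_itv y0.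
rewrite /saw; have -> : Num.floor (y / D%:R) = (Num.truncn y %/ D)%N%:Z.
  apply: Num.Theory.floor_def; apply/andP; split.
    rewrite ler_pdivlMr// -[_%:~R]/((_ %/ _)%N%:R) -natrM; apply: le_trans h1.
    by rewrite ler_nat leq_trunc_div.
  rewrite ltr_pdivrMr//; apply: lt_le_trans h2 _.
  rewrite intrD -[X in X + _]/((_ %/ _)%N%:R) natr1 -natrM ler_nat.
  exact: ltn_ceil.
rewrite -[(_ %/ _)%N%:Z%:~R]/((_ %/ _)%N%:R).
by move: (_ %/ _)%N%:R (y / _) => u v; ring.
Qed.

Lemma weighted_floor_sum (R : realType) (b n : nat) (y : R) : 0 <= y ->
  \sum_(1 <= d < n.+1) (d%:R ^+ b * (Num.truncn y %/ d ^ b)%N%:R) =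
  y * n%:R - 2^-1 * \sum_(1 <= d < n.+1) d%:R ^+ b
  - \sum_(1 <= d < n.+1) d%:R ^+ b * saw (y / d%:R ^+ b).
Proof.
move=> y0; have -> : y * n%:R = \sum_(1 <= d < n.+1) y.
  by rewrite sumr_const_nat subn1 -[RHS]mulr_natr.
rewrite mulr_sumr -!sumrB; apply: eq_big_nat => d /andP[d0 _].
have dp : 0 < d%:R ^+ b :> R by rewrite exprn_gt0// ltr0n.
rewrite natr_divn_saw// ?expn_gt0 ?d0// natrX.
by rewrite !mulrBr [X in X - _ - _]mulrCA divff ?gt_eqF// mulr1; ring.
Qed.

Lemma mobius_sum_le (R : realType) (u v : nat -> R) (N : nat) :
  (forall k, (0 < k <= N)%N -> `|u k| <= v k) ->
  `|\sum_(1 <= k < N.+1) (mobius k)%:~R * u k| <= \sum_(1 <= k < N.+1) v k.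
Proof.
move=> h; apply: le_trans (ler_norm_sum _ _ _) _.
apply: ler_sum_nat => k hk; rewrite normrM; apply: le_trans _ (h k hk).
have m1 : `|(mobius k)%:~R| <= 1 :> R.
  by rewrite -intr_norm -[leRHS]/(1%:~R) ler_int norm_mobius_le1.
by rewrite -[leRHS]mul1r; apply: ler_wpM2r.
Qed.

Lemma quotient_itv (R : realType) (x : R) (k : nat) : 0 <= x ->
  (0 < k <= Num.truncn x)%N ->
  (0 < Num.truncn x %/ k)%N /\
  (Num.truncn x %/ k)%N%:R <= x / k%:R < (Num.truncn x %/ k).+1%:R.
Proof.
move=> x0 /andP[k0 kN]; split; first by rewrite divn_gt0.
have kp : 0 < k%:R :> R by rewrite ltr0n.
have /andP[h1 h2] := Num.Theory.truncn_itv x0.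
rewrite ler_pdivlMr// ltr_pdivrMr// -!natrM; apply/andP; split.
  by apply: le_trans h1; rewrite ler_nat leq_trunc_div.
by apply: lt_le_trans h2 _; rewrite ler_nat ltn_ceil.
Qed.

(** No infinite Moebius series appears: [sum_mobius_div] gives an exact finite identity with partial
    zeta sums. Replacing each of them by z shows that S z - 1 is a sum of zeta tails, and z >= 1
    allows the division. *)
Lemma mobius_zeta (R : realType) (b : nat) (x : R) : (0 < b)%N -> 1 <= x ->
  `|\sum_(1 <= k < (Num.truncn x).+1) (mobius k)%:~R * (k%:R ^+ b.+1)^-1
    - (zeta ((1 + b)%N%:R : R))^-1| <= 2 ^+ b / x ^+ b * (1 + ln x).
Proof.
move=> b0 x1; have x0 : 0 < x by lra.
set N := Num.truncn x; set z := zeta _; set S := \sum_(_ <= _ < _) _.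
have N0 : (0 < N)%N by rewrite Num.Theory.truncn_gt0.
have Nx : N%:R <= x by have /andP[] := Num.Theory.truncn_itv (ltW x0).
have z1 : 1 <= z.
  have /andP[] := @zeta_partial_approx R b 1 b0 isT.
  by rewrite /zeta_partial big_nat1 expr1n invr1.
have inv : \sum_(1 <= k < N.+1) (mobius k)%:~R * ((k%:R ^+ b.+1)^-1 * zeta_partial R b (N %/ k)) = 1.
  have := @sum_mobius_div R (fun n => (n%:R ^+ b.+1)^-1) N N0.
  rewrite expr1n invr1 => e; rewrite -[RHS]e; apply: eq_bigr => k _; congr (_ * _).
  rewrite /zeta_partial mulr_sumr; apply: eq_bigr => d _.
  by rewrite natrM exprMn invfM.
have zp : 0 < z by lra.
suff : `|S * z - 1| <= 2 ^+ b / x ^+ b * (1 + ln x).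
  move=> h; have -> : S - z^-1 = (S * z - 1) / z.
    by rewrite mulrBl mul1r mulfK ?gt_eqF.
  rewrite normrM normfV (ger0_norm (ltW zp)) ler_pdivrMr//.
  apply: le_trans h _; rewrite ler_peMr// mulr_ge0 ?divr_ge0 ?exprn_ge0//.
    exact: ltW.
  by rewrite addr_ge0// ln_ge0.
rewrite -{1}inv /S mulr_suml -sumrB.
rewrite (eq_bigr (fun k => (mobius k)%:~R *
   ((k%:R ^+ b.+1)^-1 * (z - zeta_partial R b (N %/ k))))); last first.
  by move=> k _; move: (k%:R ^+ _)^-1 => u; ring.
apply: le_trans (@mobius_sum_le R _ (fun k => 2 ^+ b / x ^+ b * k%:R^-1) N _) _.
  move=> k hk; have [n0 /andP[n1 n2]] := quotient_itv (ltW x0) hk.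
  have /andP[k0 kN] := hk; have kp : 0 < k%:R :> R by rewrite ltr0n.
  have /andP[h1 h2] := @zeta_partial_approx R b (N %/ k) b0 n0.
  have np : 0 < (N %/ k)%N%:R :> R by rewrite ltr0n.
  have n1' : 1 <= (N %/ k)%N%:R :> R by rewrite ler1n.
  have kb : 0 < k%:R ^+ b.+1 :> R by rewrite exprn_gt0.
  rewrite normrM normfV (ger0_norm (ltW kb)) ger0_norm; last by rewrite subr_ge0.
  apply: (@le_trans _ _ ((k%:R ^+ b.+1)^-1 * (((N %/ k)%N%:R ^+ b)^-1))).
    by apply: ler_wpM2l; [rewrite invr_ge0 ltW|rewrite lerBlDl].
  (* The tail is governed by the integer quotient n of N by k, and x/k < n + 1 <= 2 n accounts for
     2^b. The powers of k then collapse to 1/k, leaving a harmonic sum. *)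
  have -> : 2 ^+ b / x ^+ b / k%:R = (k%:R ^+ b.+1)^-1 * ((x / k%:R / 2) ^+ b)^-1.
    have kn : k%:R ^+ b != 0 :> R by rewrite expf_neq0// gt_eqF.
    rewrite !expr_div_n !invfM !invrK exprS invfM.
    by rewrite [LHS]mulrC -!mulrA; congr (_ * _); rewrite mulrCA mulKf//; ring.
  apply: ler_wpM2l; first by rewrite invr_ge0 ltW.
  rewrite lef_pV2 ?posrE ?exprn_gt0 ?divr_gt0//.
  apply: lerXn2r; rewrite ?nnegrE//; first by rewrite !divr_ge0// ltW.
  by rewrite ler_pdivrMr// ltW// (lt_le_trans n2)// -natr1; lra.
rewrite -mulr_sumr; apply: ler_wpM2l.
  by rewrite divr_ge0 ?exprn_ge0// ltW.
apply: le_trans (harmonic_le R N0) _; rewrite lerD2l ler_ln ?posrE ?ltr0n//.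
Qed.

(** Each inner power sum is replaced by (x/k)^(b+1)/(b+1), at the cost of the first error term. What
    remains is x^(b+1)/(b+1) times the truncated Moebius sum of [mobius_zeta], whose error x^-b log
    x gives the second. *)
Lemma jordan_sum_approx (R : realType) (b : nat) (x : R) : (0 < b)%N -> 1 <= x ->
  `|\sum_(1 <= k < (Num.truncn x).+1) (mobius k)%:~R *
      \sum_(1 <= d < (Num.truncn x %/ k).+1) d%:R ^+ b
    - x ^+ b.+1 / (b.+1%:R * zeta ((1 + b)%N%:R : R))| <=
  2 ^+ b * (\sum_(1 <= k < (Num.truncn x).+1) (x / k%:R) ^+ b + x * (1 + ln x)).
Proof.
move=> b0 x1; have x0 : 0 < x by lra.
have mz := @mobius_zeta R b x b0 x1.
move: mz; set z := zeta _; set N := Num.truncn x; set S := \sum_(1 <= k < _) _ * _^-1 => mz.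
have bp : 0 < b.+1%:R :> R by rewrite ltr0n.
have l0 : 0 <= 1 + ln x by rewrite addr_ge0// ln_ge0.
rewrite (_ : _ - _ = \sum_(1 <= k < N.+1) (mobius k)%:~R *
     (\sum_(1 <= d < (N %/ k).+1) d%:R ^+ b - (x / k%:R) ^+ b.+1 / b.+1%:R)
   + x ^+ b.+1 / b.+1%:R * (S - z^-1)); last first.
  under [X in _ = X + _]eq_bigr do rewrite mulrBr.
  rewrite sumrB mulrBr invfM addrA mulrA; congr (_ - _).
  rewrite -addrA; symmetry; rewrite -[RHS]addr0; congr (_ + _).
  rewrite /S mulr_sumr -sumrN -big_split/= big1// => k _.
  by rewrite expr_div_n; move: (k%:R ^+ _)^-1 b.+1%:R^-1 => u v; ring.
apply: le_trans (ler_normD _ _) _; rewrite [leRHS]mulrDr; apply: lerD.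
  rewrite mulr_sumr; apply: mobius_sum_le => k hk.
  have [n0 h] := quotient_itv (ltW x0) hk.
  exact: sum_pow_approx.
rewrite normrM ger0_norm; last by rewrite divr_ge0 ?exprn_ge0// ltW.
apply: (@le_trans _ _ (x ^+ b.+1 * (2 ^+ b / x ^+ b * (1 + ln x)))).
  apply: ler_pM => //.
    by rewrite divr_ge0 ?exprn_ge0// ltW.
  rewrite ler_pdivrMr// ler_peMr ?exprn_ge0 ?ler1n//; exact: ltW.
have -> : x ^+ b.+1 * (2 ^+ b / x ^+ b * (1 + ln x)) =
   2 ^+ b * (x * (1 + ln x)) * (x ^+ b / x ^+ b) by rewrite exprS; ring.
by rewrite divff ?mulr1// expf_neq0// gt_eqF.
Qed.

(** * Summation of the errors over k *)

(** Compares every exponent a >= 3/2 with the one series already summed, k^(-3/2). The threshold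
    covers integer exponents from 2 on and (1+2b)/3 >= 5/3 for b >= 2. *)
Lemma inv_powR_le (R : realType) (a : R) (k : nat) : (0 < k)%N -> 3 / 2 <= a ->
  (k%:R^-1) `^ a <= Num.sqrt k%:R / k%:R ^+ 2.
Proof.
move=> k0 a32; have kp : 0 < k%:R :> R by rewrite ltr0n.
have k1 : 0 < (k%:R^-1 : R) <= 1 by rewrite invr_gt0 kp invf_le1// ler1n.
apply: le_trans (ger_powR k1 a32) _.
have -> : 3 / 2 = 1 + 2^-1 :> R by field.
rewrite powRD ?gt_eqF ?implybT ?invr_gt0// powRr1 ?invr_ge0 ?(ltW kp)//.
rewrite powR12_sqrt ?invr_ge0 ?(ltW kp)// sqrtrV ?(ltW kp)//.
set r := Num.sqrt _; have r0 : 0 < r by rewrite sqrtr_gt0.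
have r2 : r ^+ 2 = k%:R by rewrite sqr_sqrtr// ltW.
by rewrite -r2 le_eqVlt; apply/orP; left; apply/eqP; field; rewrite gt_eqF.
Qed.

Lemma inv_exp_le (R : realType) (n k : nat) : (0 < k)%N -> (2 <= n)%N ->
  (k%:R^-1) ^+ n <= Num.sqrt k%:R / k%:R ^+ 2 :> R.
Proof.
move=> k0 n2; rewrite -powR_mulrn ?invr_ge0//; apply: inv_powR_le => //.
by have : 2%:R <= n%:R :> R by [rewrite ler_nat]; lra.
Qed.

Lemma sum_inv_exp_le (R : realType) (n N : nat) (x : R) : 0 <= x -> (2 <= n)%N ->
  \sum_(1 <= k < N.+1) (x / k%:R) ^+ n <= 3 * x ^+ n.
Proof.
move=> x0 n2; under eq_bigr do rewrite exprMn.
rewrite -mulr_sumr mulrC; apply: ler_wpM2r; first exact: exprn_ge0.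
apply: le_trans (sum_inv_sqrt3_le3 R N).
by apply: ler_sum_nat => k /andP[k0 _]; exact: inv_exp_le.
Qed.

Lemma sum_inv_le_log (R : realType) (x : R) : expR 1 <= x ->
  \sum_(1 <= k < (Num.truncn x).+1) x / k%:R <= 2 * (x * ln x).
Proof.
move=> xe; have e2 := expR_ge1Dx (1 : R).
have x0 : 0 < x by lra.
have N0 : (0 < Num.truncn x)%N by rewrite Num.Theory.truncn_gt0; lra.
have l1 : 1 <= ln x by rewrite -[1](expRK 1) ler_ln ?posrE ?expR_gt0.
rewrite -mulr_sumr mulrCA; apply: ler_wpM2l; first exact: ltW.
apply: le_trans (harmonic_le R N0) _.
have : ln (Num.truncn x)%:R <= ln x.
  rewrite ler_ln ?posrE ?ltr0n//.
  by have /andP[] := Num.Theory.truncn_itv (ltW x0).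
lra.
Qed.

(** The case distinction of the theorem arises here. For b = 1 the exponent (1+2b)/3 equals 1 and
    the sum over k is harmonic; for b >= 2 it exceeds 3/2 and the sum costs a factor 3. The term in
    1/y has exponent at least 3 and always converges. *)
Lemma sum_voronoi_err_le (R : realType) (b : nat) (x y : R) : (0 < b)%N ->
  expR 1 <= x -> x ^+ b <= y ->
  \sum_(1 <= k < (Num.truncn x).+1) voronoi_err b y (x / k%:R) <=
    3 * error_bound b x y.
Proof.
move=> b0 xe xy; have e2 := expR_ge1Dx (1 : R).
have x0 : 0 < x by lra.
have y0 : 0 < y by apply: lt_le_trans xy; exact: exprn_gt0.
have l1 : 1 <= ln x by rewrite -[1](expRK 1) ler_ln ?posrE ?expR_gt0.
rewrite /voronoi_err big_split/= -!mulr_suml /error_bound.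
set w := y `^ (1 / 3); have w0 : 0 <= w by exact: powR_ge0.
set N := Num.truncn x.
have h1 : (\sum_(1 <= k < N.+1) (x / k%:R) ^+ (1 + 2 * b)) / y <= 3 * (x ^+ (1 + 2 * b) / y).
  rewrite mulrA; apply: ler_wpM2r; first by rewrite invr_ge0 ltW.
  by apply: sum_inv_exp_le; [exact: ltW|lia].
case: ifP => [/eqP b1|/negbT b1].
  move: h1; rewrite {1 2 4}b1 => h1.
  have h2 : (\sum_(1 <= k < N.+1) (x / k%:R) `^ ((1 + 2 * b)%N%:R / 3)) * w <=
      2 * (x * ln x) * w.
    apply: ler_wpM2r => //; apply: le_trans (sum_inv_le_log xe).
    apply: ler_sum => k _; rewrite b1 (_ : _ / 3 = 1); last by field.
    by rewrite powRr1// divr_ge0// ltW.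
  have h3 : 0 <= x * ln x * w by rewrite !mulr_ge0//; lra.
  have -> : x ^+ 3 / y = x ^+ (1 + 2 * 1) / y by [].
  rewrite b1 in h2 *; move: h1 h2 h3; rewrite -!mulrA; lra.
have b2 : (2 <= b)%N by lia.
rewrite mulrDr; apply: lerD; last exact: h1.
rewrite mulrA; apply: ler_wpM2r => //.
have a32 : 3 / 2 <= (1 + 2 * b)%N%:R / 3 :> R.
  have : 5%:R <= (1 + 2 * b)%N%:R :> R by rewrite ler_nat; lia.
  lra.
under eq_bigr do rewrite powRM ?invr_ge0 ?(ltW x0)//.
rewrite -mulr_sumr mulrC; apply: ler_wpM2r; first exact: powR_ge0.
apply: le_trans (sum_inv_sqrt3_le3 R N).
by apply: ler_sum_nat => k /andP[k0 _]; exact: inv_powR_le.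
Qed.

(** The error of the Jordan totient sum must fit inside the stated remainder. For b = 1 it has order
    x log x, covered because y >= 1; for b >= 2 it has order x^b, which needs y >= x^b. *)
Lemma low_order_le (R : realType) (b : nat) (x y : R) : (0 < b)%N ->
  expR 1 <= x -> x ^+ b <= y ->
  \sum_(1 <= k < (Num.truncn x).+1) (x / k%:R) ^+ b + x * (1 + ln x) <=
    5 * error_bound b x y.
Proof.
move=> b0 xe xy; have e2 := expR_ge1Dx (1 : R).
have x0 : 0 < x by lra.
have x1 : 1 <= x by lra.
have y1 : 1 <= y by apply: le_trans xy; rewrite exprn_ege1.
have y0 : 0 < y by lra.
have l1 : 1 <= ln x by rewrite -[1](expRK 1) ler_ln ?posrE ?expR_gt0.
rewrite /error_bound; case: ifP => [/eqP b1|/negbT b1].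
  have w1 : 1 <= y `^ (1 / 3).
    have := @ler_powR R y y1 0 (1 / 3); rewrite powRr0; apply; lra.
  have h := sum_inv_le_log xe.
  have h3 : 0 <= x ^+ 3 / y by rewrite divr_ge0 ?exprn_ge0 ?ltW.
  have h4 : x * ln x <= x * y `^ (1 / 3) * ln x.
    rewrite mulrAC ler_peMr// mulr_ge0//; lra.
  have h5 : x <= x * ln x by rewrite ler_peMr// ltW.
  rewrite b1; under eq_bigr do rewrite expr1.
  lra.
have b2 : (2 <= b)%N by lia.
have h := sum_inv_exp_le (Num.truncn x) (ltW x0) b2.
have xx : x ^+ 2 <= x ^+ b by apply: ler_weXn2l.
have lx := ln_sublinear x0.
have h1 : x * (1 + ln x) <= 2 * x ^+ b.
  apply: (@le_trans _ _ (2 * x ^+ 2)); last by lra.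
  have : x * ln x <= x * x by apply: ler_wpM2l; lra.
  have : x * 1 <= x * x by apply: ler_wpM2l; lra.
  rewrite expr2; lra.
have h2 : 0 <= x ^+ (1 + 2 * b) / y by rewrite divr_ge0 ?exprn_ge0 ?ltW.
suff : x ^+ b <= x `^ ((1 + 2 * b)%N%:R / 3) * y `^ (1 / 3) by lra.
(* The exponents (1+2b)/3 and b/3 add up to b + 1/3 >= b, and x^(b/3) <= y^(1/3) by hypothesis. *)
apply: (@le_trans _ _ (x `^ ((1 + 2 * b)%N%:R / 3) * x `^ (b%:R / 3))).
  rewrite -powRD; last by rewrite (gt_eqF x0) implybT.
  rewrite -powR_mulrn ?(ltW x0)//; apply: ler_powR => //.
  rewrite natrD natrM; lra.
apply: ler_wpM2l; first exact: powR_ge0.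
have -> : x `^ (b%:R / 3) = (x ^+ b) `^ (1 / 3).
  by rewrite -powR_mulrn ?(ltW x0)// -powRrM mul1r.
by apply: ge0_ler_powR; rewrite ?nnegrE ?exprn_ge0 ?divr_ge0// ltW.
Qed.

Lemma normc_real (R : rcfType) (r : R) : `|r%:C| = `|r|%:C.
Proof. by rewrite normc_def/= expr0n/= addr0 sqrtr_sqr. Qed.

Theorem theorem7p1 (R : realType) (beta : nat) (beta_gt0 : (0 < beta)%N) :
  exists (Rem : R -> R -> R[i]) (K x0 : R),
    forall x y : R, x0 <= x -> x ^+ beta <= y ->
      C1 beta x y =
        (y - x ^+ (1 + beta) /
             (2 * (1 + beta)%N%:R * zeta ((1 + beta)%N%:R : R)))%:C
        + Rem x y
      /\ `|Rem x y| <= (K * error_bound beta x y)%:C.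
Proof.
pose main (x y : R) := y - x ^+ (1 + beta) /
  (2 * (1 + beta)%N%:R * zeta ((1 + beta)%N%:R : R)).
pose T := 4 * 2 ^+ beta * (21 * exp_sum_cst R beta).
(* The remainder is defined as the difference, so only its bound needs proof. K adds half the Jordan
   error, 5 times 2^beta, to 3 times the sawtooth constant T; starting at x = e ensures ln x >=
   1. *)
exists (fun x y => C1 beta x y - (main x y)%:C), (2 ^+ beta * 5 / 2 + T * 3), (expR 1).
move=> x y xe xy; split; first by rewrite addrC subrK.
have e2 := expR_ge1Dx (1 : R).
have x0 : 0 < x by lra.
have x1 : 1 <= x by lra.
have y0 : 0 < y by apply: lt_le_trans xy; exact: exprn_gt0.
have A18 := @exp_sum_cst_ge R beta beta_gt0.
have T0 : 0 <= T.
  by apply: mulr_ge0; [rewrite mulr_ge0 ?exprn_ge0|lra].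
rewrite C1_mobius// -rmorphB/= normc_real lecR.
set N := Num.truncn x.
have N0 : (0 < N)%N by rewrite Num.Theory.truncn_gt0.
under eq_bigr do rewrite weighted_floor_sum ?(ltW y0)// !mulrBr.
rewrite !sumrB.
(* The main term y arises without error, because the Moebius sum of the integer quotients of N
   equals 1. *)
have -> : \sum_(1 <= k < N.+1) (mobius k)%:~R * (y * (N %/ k)%N%:R) = y.
  have e := @sum_mobius_div R (fun=> 1) N N0.
  rewrite -[RHS]mulr1 -[X in _ = _ * X]e mulr_sumr; apply: eq_bigr => k _.
  by rewrite sumr_const_nat subn1 mulrCA.
have -> : \sum_(1 <= k < N.+1) (mobius k)%:~R *
     (2^-1 * \sum_(1 <= d < (N %/ k).+1) d%:R ^+ beta) =
   2^-1 * \sum_(1 <= k < N.+1) (mobius k)%:~R *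
     \sum_(1 <= d < (N %/ k).+1) d%:R ^+ beta :> R.
  by rewrite mulr_sumr; apply: eq_bigr => k _; rewrite mulrCA.
have hJ := @jordan_sum_approx R beta x beta_gt0 x1.
have hL := low_order_le beta_gt0 xe xy.
have hV := sum_voronoi_err_le beta_gt0 xe xy.
have hB : `|\sum_(1 <= k < N.+1) (mobius k)%:~R *
     \sum_(1 <= d < (N %/ k).+1) d%:R ^+ beta * saw (y / d%:R ^+ beta)| <=
   T * \sum_(1 <= k < N.+1) voronoi_err beta y (x / k%:R).
  rewrite mulr_sumr; apply: mobius_sum_le => k hk.
  have [n0 /andP[n1 n2]] := quotient_itv (ltW x0) hk.
  apply: le_trans (voronoi_bound _ beta_gt0 y0) _.
  apply: ler_wpM2l => //; apply: le_voronoi_err => //; exact: ltW.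
have hB2 := le_trans hB (ler_wpM2l T0 hV).
have p0 : 0 <= 2 ^+ beta :> R by rewrite exprn_ge0.
have hJ2 := le_trans hJ (ler_wpM2l p0 hL).
move: hJ2 hB2; rewrite /main -/N !add1n.
set z := zeta _; set J := \sum_(_ <= _ < _) _ * \sum_(_ <= _ < _) (_ ^+ _).
set B := \sum_(_ <= _ < _) _; set E := error_bound _ _ _.
have -> : x ^+ beta.+1 / (2 * beta.+1%:R * z) = 2^-1 * (x ^+ beta.+1 / (beta.+1%:R * z)).
  by rewrite -mulrA invfM; ring.
move: (x ^+ _ / _) (2 ^+ _) => m q; rewrite !ler_norml; lra.
Qed.
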